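(* Consider the network model, the objective $\mathcal{L}$ and the two-phase training procedure described in the context. Suppose $H\ge 2$ and that the following hold. (Expressivity condition) There exists $w_{(1:H)}$ such that $\varphi(w_{(1:H)})\neq 0$, where $\varphi(w_{(1:H)}):=\det\big([h_X^{(H)}(w_{(1:H)}),\mathbf{1}_n]\,[h_X^{(H)}(w_{(1:H)}),\mathbf{1}_n]^\top\big)$. (Loss) For any $i\in\{1,\dots,n\}$, the function $\ell_i:q\mapsto\ell(q,y_i)\in\mathbb{R}_{\ge 0}$ is differentiable and convex, and $\nabla\ell_i$ is $L_\ell$-Lipschitz: $\|\nabla\ell_i(q)-\nabla\ell_i(q')\|\le L_\ell\|q-q'\|$ for all $q,q'\in\mathbb{R}^{m_y}$. (Analyticity) The function $h_X^{(H)}$ is real analytic. Let $w^*\in\mathbb{R}^d$ be a global minimum of $\mathcal{L}$. Let $R^2=\min_{\bar w^*_{(H+1)}\in Q}\mathbb{E}\big[\|\bar w^*_{(H+1)}-w^\tau_{(H+1)}\|^2\big]$, where $Q=\operatorname{argmin}_{w_{(H+1)}}\mathcal{L}\big([(w^\tau_{(1:H)})^\top,(w_{(H+1)})^\top]^\top\big)$. Then, with probability one over a randomly sampled $\delta$, the following two statements hold. (i) (Gradient descent) If for $t\ge\tau$ the second-phase update is made with $g^t=\nabla_{w^t_{(H+1)}}\mathcal{L}(w^t)$ and $\eta_t=\frac{1}{L_H}\nu$, that is, $w^{t+1}_{(1:H)}=w^t_{(1:H)}$ and $w^{t+1}_{(H+1)}=w^t_{(H+1)}-\frac{1}{L_H}g^t$,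 with $L_H=\frac{L_\ell}{n}\sum_{i=1}^n\big\|[h^{(H)}(x_i,w^\tau_{(1:H)}),1]\big\|_2^2$, then for any $t>\tau$, $$\mathcal{L}(w^t)-\mathcal{L}(w^* )\le\frac{R^2L_H}{2(t-\tau)}.$$ (ii) (SGD) If for $t\ge\tau$ the second-phase update is made with $g^t$ satisfying $\mathbb{E}[g^t\mid w^t]=\nabla_{w^t_{(H+1)}}\mathcal{L}(w^t)$ (almost surely) and $\mathbb{E}[\|g^t\|^2]\le G^2$, and with $\eta_t=\bar\eta_t\nu$, that is, $w^{t+1}_{(1:H)}=w^t_{(1:H)}$ and $w^{t+1}_{(H+1)}=w^t_{(H+1)}-\bar\eta_t g^t$, where $\bar\eta_t\in\mathbb{R}$ satisfy $\bar\eta_t\ge 0$, $\sum_{t=\tau}^\infty\bar\eta_t^2<\infty$ and $\sum_{t=\tau}^\infty\bar\eta_t=\infty$, then for any $t>\tau$, $$\mathbb{E}[\mathcal{L}(w^{t^*})]-\mathcal{L}(w^* )\le\frac{R^2+G^2\sum_{k=\tau}^t\bar\eta_k^2}{2\sum_{k=\tau}^t\bar\eta_k},$$ where $t^*\in\operatorname{argmin}_{k\in\{\tau,\tau+1,\dots,t\}}\mathcal{L}(w^k)$.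
   Context: Data and model: $((x_i,y_i))_{i=1}^n$ is a training dataset with $x_i\in\mathcal{X}\subseteq\mathbb{R}^{m_x}$ and $y_i\in\mathcal{Y}\subseteq\mathbb{R}^{m_y}$, and $\ell:\mathbb{R}^{m_y}\times\mathcal{Y}\to\mathbb{R}_{\ge0}$ is a loss. The network has $H$ hidden layers. Its trainable parameter vector is $w=[w_{(1:H)}^\top,w_{(H+1)}^\top]^\top\in\mathbb{R}^d$, where $w_{(1:H)}=[w_{(1)}^\top,\dots,w_{(H)}^\top]^\top\in\mathbb{R}^{d_{1:H}}$ collects the parameters $w_{(l)}\in\mathbb{R}^{d_l}$ of the hidden layers, and $w_{(H+1)}\in\mathbb{R}^{d_{H+1}}$ is the vectorization of the last-layer weight matrix stacked on the bias, $\begin{bmatrix}W^{(H+1)}\\ b^{(H+1)}\end{bmatrix}$, with $W^{(H+1)}\in\mathbb{R}^{m_H\times m_y}$ and $b^{(H+1)}\in\mathbb{R}^{1\times m_y}$. The outputs of the last hidden layer on the whole dataset form the matrix $h_X^{(H)}(w_{(1:H)})\in\mathbb{R}^{n\times m_H}$, which is determined by the architecture and the dataset; its $i$-th row is denoted $h^{(H)}(x_i,w_{(1:H)})$ and may depend on all of $x_1,\dots,x_n$. The network output is $$f_X(w)=[h_X^{(H)}(w_{(1:H)}),\mathbf{1}_n]\begin{bmatrix}W^{(H+1)}\\ b^{(H+1)}\end{bmatrix}\in\mathbb{R}^{n\times m_y},$$ where $\mathbf{1}_n\in\mathbb{R}^n$ is the all-ones vector; its $i$-th row is $f(x_i,w)$.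 The objective is $\mathcal{L}(w)=\frac1n\sum_{i=1}^n\ell(f(x_i,w)^\top,y_i)$. Two-phase training: given an initial vector $w^0$, a time $\tau$ and a first-order base algorithm with updates $g^t$ and learning rates $\eta_t$, the first phase sets $w^{t+1}=w^t-\eta_t\odot g^t$ for $t=0,\dots,\tau-1$ ($\odot$ is the entrywise product). Then noise is added at time $\tau$: $w^\tau_{(1:H)}\leftarrow w^\tau_{(1:H)}+\delta$, where $\delta=(\delta_1,\dots,\delta_H)\in\mathbb{R}^{d_{1:H}}$ is sampled from a non-degenerate Gaussian distribution, $\delta_h\sim N(0,\sigma_h^2I_{d_h})$ for $h=1,\dots,H$. From then on $w^\tau$ denotes the perturbed vector. The second phase sets $w^{t+1}=w^t-\eta_t\odot g^t$ for $t=\tau,\tau+1,\dots$. The vector $\nu=[\mathbf{0}_{d_{1:H}}^\top,\mathbf{1}_{d_{H+1}}^\top]^\top\in\mathbb{R}^d$ has zeros in the hidden-layer coordinates and ones in the last-layer coordinates. *)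

(* Defs.v *)
From HB Require Import structures.
From mathcomp Require Import all_boot all_order all_algebra.
From mathcomp Require Import all_classical all_reals all_analysis.

Set Implicit Arguments.
Unset Strict Implicit.
Unset Printing Implicit Defensive.

Import Order.TTheory GRing.Theory Num.Theory.
Import numFieldNormedType.Exports.

Local Open Scope classical_set_scope.
Local Open Scope ring_scope.

(* The library norm on matrices is the sup norm; this is the Euclidean one. *)
Definition sqnorm2 (R : realType) (m k : nat) (A : 'M[R]_(m, k)) : R :=
  \sum_i \sum_j A i j ^+ 2.

Definition norm2 (R : realType) (m k : nat) (A : 'M[R]_(m, k)) : R :=
  Num.sqrt (sqnorm2 A).

Definition gradient (R : realType) (k : nat) (f : 'cV[R]_k -> R)
    (x : 'cV[R]_k) : 'cV[R]_k :=
  \col_i 'D_(delta_mx i 0) f x.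

(* [f] is the sum, on a neighbourhood of each point [a], of an absolutely
   convergent power series [\sum_alpha c_alpha (x - a)^alpha] over
   multi-indices; because of absolute convergence it is harmless to sum over
   the growing boxes [{0, ..., N-1}^k]. *)
Definition real_analytic (R : realType) (k : nat) (f : 'cV[R]_k -> R) : Prop :=
  forall a : 'cV[R]_k, exists c : {ffun 'I_k -> nat} -> R,
    let term (x : 'cV[R]_k) (alpha : {ffun 'I_k -> nat}) : R :=
      c alpha * \prod_i (x i 0 - a i 0) ^+ alpha i in
    let box_sum (F : {ffun 'I_k -> nat} -> R) : R^nat := fun N =>
      \sum_(b : {ffun 'I_k -> 'I_N}) F [ffun i => nat_of_ord (b i)] in
    \forall x \near a,
      cvgn (box_sum (fun alpha => `|term x alpha|)) /\
      box_sum (term x) @ \oo --> f x.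

(* Inverse of the column-stacking vectorization of [W; b]. *)
Definition last_matrix (R : realType) (mH my : nat)
    (v : 'cV[R]_(my * (mH + 1))) : 'M[R]_(mH + 1, my) :=
  (vec_mx v^T)^T.

Definition augment (R : realType) (n mH : nat) (A : 'M[R]_(n, mH)) :
    'M[R]_(n, mH + 1) :=
  row_mx A (const_mx 1).

(* Below [hX] is the map sending the hidden-layer parameters to the outputs of
   the last hidden layer on the whole dataset. *)
Definition expressivity_det (R : realType) (n mH dh : nat)
    (hX : 'cV[R]_dh -> 'M[R]_(n, mH)) (u : 'cV[R]_dh) : R :=
  \det (augment (hX u) *m (augment (hX u))^T).

Definition network (R : realType) (n mH my dh : nat)
    (hX : 'cV[R]_dh -> 'M[R]_(n, mH))
    (w : 'cV[R]_(dh + my * (mH + 1))) : 'M[R]_(n, my) :=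
  augment (hX (usubmx w)) *m last_matrix (dsubmx w).

Definition objective (R : realType) (n mH my dh : nat)
    (hX : 'cV[R]_dh -> 'M[R]_(n, mH)) (ell : 'cV[R]_my -> 'cV[R]_my -> R)
    (y : 'I_n -> 'cV[R]_my) (w : 'cV[R]_(dh + my * (mH + 1))) : R :=
  n%:R^-1 * \sum_i ell (row i (network hX w))^T (y i).

Definition last_gradient (R : realType) (dh dl : nat)
    (L : 'cV[R]_(dh + dl) -> R) (w : 'cV[R]_(dh + dl)) : 'cV[R]_dl :=
  gradient (fun v => L (col_mx (usubmx w) v)) (dsubmx w).

Definition last_argmin (R : realType) (dh dl : nat)
    (L : 'cV[R]_(dh + dl) -> R) (u : 'cV[R]_dh) : set 'cV[R]_dl :=
  [set v | forall v', L (col_mx u v) <= L (col_mx u v')].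

Definition smoothness_const (R : realType) (n mH dh : nat)
    (hX : 'cV[R]_dh -> 'M[R]_(n, mH)) (Lell : R) (u : 'cV[R]_dh) : R :=
  Lell / n%:R * \sum_i norm2 (row i (augment (hX u))) ^+ 2.

Fixpoint first_phase (R : realType) (k : nat) (w0 : 'cV[R]_k)
    (eta g : nat -> 'cV[R]_k) (t : nat) : 'cV[R]_k :=
  if t is s.+1 then
    first_phase w0 eta g s - map2_mx *%R (eta s) (g s)
  else w0.

Definition random_vector (R : realType) (d : measure_display)
    (T : measurableType d) (k : nat) (X : T -> 'cV[R]_k) : Prop :=
  forall i, measurable_fun setT (fun omega => X omega i 0).

(* [delta = (delta_1, ..., delta_H)] with independent blocks
   [delta_l ~ N(0, sigma_l^2 I)]: all the coordinates are independent, those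
   of block [l] having law N(0, sigma_l^2). *)
Definition block_gaussian (R : realType) (d : measure_display)
    (T : measurableType d) (P : probability T R) (H : nat) (dim : 'I_H -> nat)
    (sigma : 'I_H -> R) (delta : T -> 'cV[R]_(\sum_(l < H) dim l)%N) : Prop :=
  random_vector delta /\
  forall A : forall l : 'I_H, 'I_(dim l) -> set R,
    (forall l j, measurable (A l j)) ->
    P [set omega | forall l j, A l j (submxcol (delta omega) l j 0)] =
    (\prod_(l < H) \prod_(j < dim l) normal_prob 0 (sigma l) (A l j))%E.

Definition sigma_generated (R : realType) (T : Type) (k : nat)
    (Z : T -> 'cV[R]_k) : set (set T) :=
  g_sigma_preimage (fun (i : 'I_k) omega => Z omega i 0).

(* [V] is a version of the conditional expectation E[X | Z]. *)
Definition is_cond_expectation (R : realType) (d : measure_display)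
    (T : measurableType d) (P : probability T R) (k : nat)
    (X : T -> R) (Z : T -> 'cV[R]_k) (V : T -> R) : Prop :=
  [/\ P.-integrable setT (EFin \o X),
      P.-integrable setT (EFin \o V),
      (forall B : set R, measurable B -> sigma_generated Z (V @^-1` B)) &
      (forall A : set T, sigma_generated Z A ->
         (\int[P]_(omega in A) (X omega)%:E =
          \int[P]_(omega in A) (V omega)%:E)%E)].

(* E[X | Z] = Y almost surely, coordinatewise. *)
Definition cond_expectation_eq (R : realType) (d : measure_display)
    (T : measurableType d) (P : probability T R) (k m : nat)
    (X : T -> 'cV[R]_m) (Z : T -> 'cV[R]_k) (Y : T -> 'cV[R]_m) : Prop :=
  forall j, exists2 V : T -> R,
    is_cond_expectation P (fun omega => X omega j 0) Z V &
    {ae P, forall omega, V omega = Y omega j 0}.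

Definition is_minimum (R : realType) (S : set (\bar R)) (m : \bar R) : Prop :=
  S m /\ lbound S m.

(* Main.v *)
(* The determinant [phi] of the expressivity condition is a polynomial in
   analytic functions, hence locally a power series along every coordinate line.
   A nonzero analytic function of one variable has countably many zeros, so
   replacing the coordinates of a point where [phi] is nonzero by the independent
   Gaussian coordinates of the perturbed parameters, one after the other, keeps
   [phi] almost surely nonzero (Fubini). Once [phi] is nonzero, the augmented
   feature matrix has full row rank, so the last layer alone attains the global
   minimum of the objective, which is convex and smooth as a function of the last
   layer. Both rates are then the classical ones for (stochastic) gradient
   descent, started from a minimizer at the smallest expected squared distance. *)
Require Import Defs.
From HB Require Import structures.
From mathcomp Require Import all_boot all_order all_algebra.
From mathcomp Require Import all_classical all_reals all_analysis.
From mathcomp Require Import measurable_realfun.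
From mathcomp Require Import ring lra.

Set Implicit Arguments.
Unset Strict Implicit.
Unset Printing Implicit Defensive.

Import Order.TTheory GRing.Theory Num.Theory.
Import numFieldNormedType.Exports.

Local Open Scope classical_set_scope.
Local Open Scope ring_scope.

(** * Power series in one variable *)

(** No identity theorem in several variables is used. On a coordinate line an analytic function is
    an ordinary power series, and for [power_series_at] closure under sums and products is
    elementary: the bound [|c n| * r ^+ n <= K] is what controls Cauchy products and tails.
    Analyticity in several variables then serves only to be restricted to lines and to give
    continuity, hence measurability. The obstacle in the stochastic half is integrability. The
    expected initial distance may be infinite, so R^2 is an extended real, and neither the objective
    along the iterates nor the pairing of the exact gradient with the distance to a minimizer is
    assumed integrable. By convexity the optimality gap lies between 0 and that pairing; this
    sandwich lets truncation and monotone convergence deliver the integrability together with the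
    inequality. The noise has its own probability space: once [delta] is fixed, R^2 and the SGD
    bound are expectations over the randomness of training alone. *)

Definition power_series_at (R : realType) (g : R -> R) (a : R) : Prop :=
  exists (c : nat -> R) (r K : R),
    [/\ 0 < r, forall n, `|c n| * r ^+ n <= K &
      forall t : R, `|t| < r ->
        (fun N => \sum_(n < N) c n * t ^+ n) @ \oo --> g (a + t)].

Section PowerSeries.
Variable R : realType.
Implicit Types (f g : R -> R) (a : R).

(** Allows two series to be taken at a common radius. *)
Lemma power_series_at_shrink g a : power_series_at g a ->
  exists r0 : R, 0 < r0 /\ forall r : R, 0 < r -> r <= r0 ->
    exists (c : nat -> R) (K : R),
    [/\ 0 <= K, forall n, `|c n| * r ^+ n <= K &
      forall t : R, `|t| < r ->
        (fun N => \sum_(n < N) c n * t ^+ n) @ \oo --> g (a + t)].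
Proof.
move=> [c [r0 [K [r0_gt0 cK cg]]]]; exists r0; split=> // r r_gt0 rr0.
exists c, K; split.
- by rewrite (le_trans _ (cK 0%N))// mulr_ge0// exprn_ge0// ltW.
- move=> n; apply: le_trans (cK n); rewrite ler_wpM2l//.
  by rewrite lerXn2r// nnegrE ltW.
- by move=> t tr; apply: cg; exact: lt_le_trans rr0.
Qed.

Let minl (x y : R) : Num.min x y <= x. Proof. by rewrite ge_min lexx. Qed.

Let minr (x y : R) : Num.min x y <= y. Proof. by rewrite ge_min lexx orbT. Qed.

Lemma power_series_at_cst (k a : R) : power_series_at (cst k) a.
Proof.
exists (fun n => if n is 0%N then k else 0), 1, `|k|; split=> //.
  by case=> [|n]; rewrite ?normr0 ?mul0r// expr0 mulr1.
move=> t _; apply: cvg_near_cst; exists 1%N => // -[//|N] _ /=; rewrite big_ord_recl/= expr0 mulr1 big1 ?addr0//.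
by move=> i _; rewrite mul0r.
Unshelve. all: by end_near. Qed.

Lemma power_series_at_add f g a : power_series_at f a -> power_series_at g a ->
  power_series_at (fun x => f x + g x) a.
Proof.
move=> /power_series_at_shrink[r1 [r1_gt0 Hf]].
move=> /power_series_at_shrink[r2 [r2_gt0 Hg]].
pose r := Num.min r1 r2.
have r_gt0 : 0 < r by rewrite lt_min r1_gt0.
have [c [K [_ cK cf]]] := Hf r r_gt0 (minl _ _).
have [d [L [_ dL dg]]] := Hg r r_gt0 (minr _ _).
exists (fun n => c n + d n), r, (K + L); split=> //.
  move=> n; apply: (@le_trans _ _ ((`|c n| + `|d n|) * r ^+ n)).
    by rewrite ler_wpM2r ?ler_normD// exprn_ge0// ltW.
  by rewrite mulrDl lerD.
move=> t tr; under eq_fun do (under eq_bigr do rewrite mulrDl); rewrite /=.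
under eq_fun do rewrite big_split/=.
by apply: cvgD; [exact: cf|exact: dg].
Qed.

Let cauchy (c d : nat -> R) n := \sum_(i < n.+1) c i * d (n - i)%N.

Let cauchy_bound (c d : nat -> R) (r K L : R) n : 0 < r -> 0 <= K ->
  (forall n, `|c n| * r ^+ n <= K) -> (forall n, `|d n| * r ^+ n <= L) ->
  `|cauchy c d n| * r ^+ n <= n.+1%:R * (K * L).
Proof.
move=> r_gt0 K0 cK dL; have rn m : 0 <= r ^+ m by rewrite exprn_ge0// ltW.
rewrite -(ger0_norm (rn n)) -normrM.
rewrite /cauchy mulr_suml.
rewrite (le_trans (ler_norm_sum _ _ _))//.
rewrite [leRHS](_ : _ = \sum_(i < n.+1) K * L); last first.
  by rewrite sumr_const card_ord mulr_natl.
apply: ler_sum => i _.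
have -> : r ^+ n = r ^+ i * r ^+ (n - i) by rewrite -exprD subnKC// -ltnS.
rewrite mulrACA normrM ler_pM// normrM (ger0_norm (rn _)).
  exact: cK.
exact: dL.
Qed.

Let ltn_2n (n : nat) : n.+1%:R <= 2 ^+ n :> R.
Proof. by rewrite -natrX ler_nat ltn_expl. Qed.

(* The product of the partial sums differs from the partial sum of the Cauchy
   product by the terms of degree between [N] and [2 N]. *)
Let cauchy_partial (c d : nat -> R) (r K L t : R) N : 0 < r -> 0 <= K -> 0 <= L ->
  (forall n, `|c n| * r ^+ n <= K) -> (forall n, `|d n| * r ^+ n <= L) ->
  `|t| < r / 8 ->
  `|(\sum_(n < N) c n * t ^+ n) * (\sum_(n < N) d n * t ^+ n) -
     \sum_(n < N) cauchy c d n * t ^+ n| <= 2 * (K * L) * 2^-1 ^+ N.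
Proof.
move=> r_gt0 K0 L0 cK dL tr.
have polyE (e : nat -> R) :
    \sum_(n < N) e n * t ^+ n = (\poly_(n < N) e n).[t] by rewrite horner_poly.
rewrite [in X in `|X * _ - _|]polyE [in X in `|_ * X - _|]polyE -hornerM.
set p := \poly_(n < N) c n; set q := \poly_(n < N) d n.
(* With truncated coefficients the product of partial sums is a polynomial product, whose
   coefficients of degree below [N] are those of the full Cauchy product, so these cancel. *)
pose c' n := if (n < N)%N then c n else 0.
pose d' n := if (n < N)%N then d n else 0.
have pq_coef n : (p * q)`_n = cauchy c' d' n.
  by rewrite coefM; apply: eq_bigr => i _; rewrite !coef_poly.
have c'K n : `|c' n| * r ^+ n <= K by rewrite /c'; case: ifP; rewrite ?normr0 ?mul0r.
have d'L n : `|d' n| * r ^+ n <= L by rewrite /d'; case: ifP; rewrite ?normr0 ?mul0r.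
rewrite (@horner_coef_wide _ (N + N)); last first.
  rewrite (leq_trans (size_polyMleq _ _))// (leq_trans (leq_pred _))//.
  by rewrite leq_add// size_poly.
rewrite big_split_ord/= addrAC -sumrB.
rewrite [X in `|X + _|]big1 ?add0r; last first.
  move=> i _; rewrite pq_coef -mulrBl [X in X * _](_ : _ = 0) ?mul0r//.
  apply/eqP; rewrite subr_eq0; apply/eqP; apply: eq_bigr => j _.
  have ji : (j <= i)%N by rewrite -ltnS.
  by rewrite /c' /d' (leq_ltn_trans ji)// (leq_ltn_trans (leq_subr _ _)).
rewrite (le_trans (ler_norm_sum _ _ _))//.
(* The remaining degrees are [n = N + i] with [i < N], so [n + 1 <= 2 N] and
   [8^-1 ^+ n <= 8^-1 ^+ N]. *)
apply: (@le_trans _ _ (\sum_(i < N) (N%:R * 2) * (K * L) * 8^-1 ^+ N)).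
  apply: ler_sum => i _; rewrite pq_coef normrM normrX.
  set n := (N + i)%N.
  apply: (@le_trans _ _ (`|cauchy c' d' n| * r ^+ n * 8^-1 ^+ n)).
    by rewrite -mulrA -exprMn ler_wpM2l// lerXn2r ?nnegrE//; apply: ltW => //; exact: le_lt_trans tr.
  have rn m : 0 <= r ^+ m by rewrite exprn_ge0// ltW.
  apply: ler_pM; rewrite ?mulr_ge0// ?exprn_ge0// ?invr_ge0//.
    apply: (le_trans (cauchy_bound n r_gt0 K0 c'K d'L)).
    rewrite ler_wpM2r ?mulr_ge0// -natrM ler_nat /n muln2 -addnn -addnS leq_add2l.
    exact: ltn_ord.
  by rewrite ler_wiXn2l ?leq_addr// ?invr_ge0// invf_le1// ler1n.
rewrite sumr_const card_ord -mulr_natl.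
(* Of the three powers of one half, two absorb the two factors [N] (number of terms and size of
   each) and the third tends to 0. *)
have -> : (8^-1 : R) = 2^-1 * 2^-1 * 2^-1 by field.
rewrite !exprMn.
have N2 : N%:R * 2^-1 ^+ N <= 1 :> R.
  rewrite exprVn ler_pdivrMr ?exprn_gt0// mul1r (le_trans _ (ltn_2n N))//.
  by rewrite ler_nat.
set u := 2^-1 ^+ N in N2 *.
have u0 : 0 <= u by rewrite /u exprn_ge0// invr_ge0.
rewrite [leLHS](_ : _ = 2 * (K * L) * ((N%:R * u) * (N%:R * u)) * u); last by ring.
rewrite ler_wpM2r// ler_piMr ?mulr_ge0// mulr_ile1// mulr_ge0//.
Qed.

Lemma power_series_at_mul f g a : power_series_at f a -> power_series_at g a ->
  power_series_at (fun x => f x * g x) a.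
Proof.
move=> /power_series_at_shrink[r1 [r1_gt0 Hf]].
move=> /power_series_at_shrink[r2 [r2_gt0 Hg]].
pose r := Num.min r1 r2.
have r_gt0 : 0 < r by rewrite lt_min r1_gt0.
have [c [K [K0 cK cf]]] := Hf r r_gt0 (minl _ _).
have [d [L [L0 dL dg]]] := Hg r r_gt0 (minr _ _).
(* Dividing the radius by 8 absorbs the factor [n + 1] of [cauchy_bound] and is what
   [cauchy_partial] asks for. *)
exists (cauchy c d), (r / 8), (K * L); split; first by rewrite divr_gt0.
  move=> n; rewrite exprMn mulrA.
  have h := cauchy_bound n r_gt0 K0 cK dL.
  apply: (@le_trans _ _ (n.+1%:R * (K * L) * 8^-1 ^+ n)).
    by rewrite ler_wpM2r// exprn_ge0// invr_ge0.
  rewrite mulrAC -[leRHS]mul1r ler_wpM2r ?mulr_ge0// exprVn.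
  rewrite ler_pdivrMr ?exprn_gt0// mul1r (le_trans (ltn_2n n))//.
  by rewrite lerXn2r ?nnegrE// ler_nat.
move=> t tr8.
have tr : `|t| < r.
  by rewrite (lt_le_trans tr8)// ler_pdivrMr// ler_peMr ?ler1n// ltW.
set C := fun N => \sum_(n < N) c n * t ^+ n.
set D := fun N => \sum_(n < N) d n * t ^+ n.
set E := fun N => \sum_(n < N) _.
have -> : E = (fun N => C N * D N - (C N * D N - E N)).
  by apply/funext => N; rewrite opprB addrC subrK.
rewrite -[X in _ --> X]subr0; apply: cvgB.
  by apply: cvgM; [exact: cf|exact: dg].
apply/cvgr0Pnorm_le => e e0.
have h : (fun N => 2 * (K * L) * 2^-1 ^+ N) @ \oo --> 2 * (K * L) * (0 : R).
  by apply: cvgMl_tmp; apply: cvg_expr; rewrite ger0_norm ?invr_ge0// invf_lt1// ltr1n.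
rewrite mulr0 in h.
move/cvgr0Pnorm_le : h => /(_ e e0); apply: filterS => N.
apply: le_trans; rewrite [leRHS]ger0_norm; last first.
  by rewrite !mulr_ge0// exprn_ge0// invr_ge0.
exact: (cauchy_partial N r_gt0 K0 L0 cK dL tr8).
Qed.

End PowerSeries.

(** * Zeros of functions that are locally power series *)

Section Dichotomy.
Variable R : realType.
Implicit Types (f g : R -> R) (a : R).

(** If [c m] is the first nonzero coefficient, [g (a + t)] differs from [c m * t ^+ m] by a multiple
    of [|t| ^+ m.+1], so the leading term wins for small nonzero [t]. *)
Lemma power_series_at_dichotomy g a : power_series_at g a ->
  (\forall x \near a, g x = 0) \/ (\forall x \near a, x != a -> g x != 0).
Proof.
move=> [c [r [K [r_gt0 cK cg]]]].
have K0 : 0 <= K by rewrite (le_trans _ (cK 0%N))// mulr_ge0// exprn_ge0// ltW.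
have [c0|] := pselect (forall n, c n = 0).
  left; near=> x.
  have xr : `|x - a| < r by rewrite distrC; near: x; exact: cvgr_dist_lt.
  have := cg _ xr; rewrite (addrC a) subrK => h.
  rewrite -(cvg_lim _ h)//; apply: cvg_lim => //; apply: cvg_near_cst.
  by near=> N; rewrite big1// => i _; rewrite c0 mul0r.
move/existsNP => [m0 /eqP cm0]; right.
have ex : exists m, c m != 0 by exists m0.
case: (ex_minnP ex) => m cm minm.
(* The terms of degree above [m] are dominated by a geometric series of ratio one half; the factor
   [2 - 2 * 2^-1 ^+ N] is its partial sum, which lets the induction close. *)
have partial t N : `|t| <= r / 2 ->
    `|\sum_(n < m.+1 + N) c n * t ^+ n - c m * t ^+ m|
       <= K * (`|t| / r) ^+ m.+1 * (2 - 2 * 2^-1 ^+ N).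
  move=> tr2; elim: N => [|N IH].
    rewrite expr0 mulr1 subrr mulr0 addn0 big_ord_recr/= addrK normr_le0.
    rewrite big1// => i _; rewrite (_ : c i = 0) ?mul0r//; apply/eqP.
    by apply: contraTT (ltn_ord i) => /minm; rewrite -leqNgt.
  rewrite addnS big_ord_recr/= addrAC (le_trans (ler_normD _ _))//.
  set s := `|t| / r in IH *.
  have s0 : 0 <= s by rewrite divr_ge0// ltW.
  have s2 : s <= 2^-1 by rewrite ler_pdivrMr// mulrC.
  have step : `|c (m.+1 + N)%N * t ^+ (m.+1 + N)%N| <= K * s ^+ m.+1 * 2^-1 ^+ N.
    rewrite normrM normrX.
    have -> : `|t| = r * s by rewrite mulrC divfK// gt_eqF.
    rewrite exprMn mulrA; set n := (m.+1 + N)%N.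
    apply: (@le_trans _ _ (K * s ^+ n)).
      by rewrite ler_wpM2r// exprn_ge0.
    by rewrite /n exprD mulrA ler_wpM2l ?mulr_ge0 ?exprn_ge0// lerXn2r ?nnegrE.
  apply: (le_trans (lerD IH step)).
  rewrite -mulrDr ler_wpM2l ?mulr_ge0 ?exprn_ge0// exprS.
  by rewrite le_eqVlt; apply/orP; left; apply/eqP; field.
have bnd t : `|t| <= r / 2 ->
    `|g (a + t) - c m * t ^+ m| <= K * (`|t| / r) ^+ m.+1 * 2.
  move=> tr2.
  have tr : `|t| < r by rewrite (le_lt_trans tr2)// gtr_pMr// invf_lt1 ?ltr1n.
  have h : `|\sum_(n < N) c n * t ^+ n - c m * t ^+ m| @[N --> \oo]
      --> `|g (a + t) - c m * t ^+ m|.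
    by apply: cvg_norm; apply: cvgB; [exact: cg|exact: cvg_cst].
  rewrite -(cvg_lim _ h)//; apply: limr_le; first by apply/cvg_ex; eexists; exact: h.
  exists m.+1 => // N /= mN; rewrite -(subnKC mN).
  apply: (le_trans (partial t _ tr2)); rewrite ler_wpM2l//.
    by rewrite mulr_ge0 ?exprn_ge0// divr_ge0// ltW.
  by rewrite lerBlDr lerDl mulr_ge0// exprn_ge0// invr_ge0.
(* A zero at distance [|t|] would give [|c m| * r ^+ m.+1 <= 2 * K * |t|]; the [+ 1] keeps the
   denominator positive when [K = 0]. *)
pose e := Num.min (r / 2) (`|c m| * r ^+ m.+1 / (2 * K + 1)).
have K1 : 0 < 2 * K + 1 by rewrite ltr_wpDl// mulr_ge0.
have e_gt0 : 0 < e.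
  by rewrite lt_min !divr_gt0// mulr_gt0 ?normr_gt0// exprn_gt0.
near=> x => xa.
have : `|x - a| < e by rewrite distrC; near: x; exact: cvgr_dist_lt.
rewrite lt_min => /andP[t1 t2].
set t := x - a in t1 t2.
have t0 : 0 < `|t| by rewrite normr_gt0 subr_eq0.
apply/eqP => gx0.
have := bnd t (ltW t1); rewrite /t (addrC a) subrK gx0 sub0r normrN -/t.
rewrite normrM normrX exprS expr_div_n => h.
have : `|c m| * `|t| ^+ m * r ^+ m.+1 <= 2 * K * `|t| * `|t| ^+ m.
  rewrite -ler_pdivlMr ?exprn_gt0//; apply: (le_trans h).
  rewrite le_eqVlt; apply/orP; left; apply/eqP.
  by rewrite exprS; field; rewrite expf_neq0 gt_eqF.
rewrite mulrAC ler_pM2r ?exprn_gt0// => {}h.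
move: t2; rewrite ltr_pdivlMr// ltNge => /negP; apply.
by rewrite (le_trans h)// mulrC ler_wpM2l// lerDl.
Unshelve. all: by end_near. Qed.

(** By the dichotomy the interior of the zero set is closed as well as open. The line is connected
    and [g b] is nonzero, so this interior is empty; every zero is then isolated, and a set of reals
    has countably many isolated points. *)
Lemma power_series_zeros_countable g b : (forall a, power_series_at g a) ->
  g b != 0 -> countable [set x | g x = 0].
Proof.
move=> gP gb.
pose S := [set x : R | g x = 0]°.
have oS : open S by exact: open_interior.
have punct a : ~ S a -> \forall x \near a, x != a -> g x != 0.
  by move=> Sa; have [//|] := power_series_at_dichotomy (gP a).
have cS : closed S.
  rewrite -[S]setCK; apply: open_closedC; rewrite openE => a /= Sa.
  have := punct _ Sa; apply: filterS => x; have [->//|xa] := eqVneq x a.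
  move=> /(_ isT) /eqP gx Sx; apply: gx.
  exact: nbhs_singleton Sx.
have S0 : S = set0.
  apply/eqP/negPn/negP => /set0P S0.
  have SbT : S b.
    suff -> : S = setT by [].
    have : connected [set: R] by apply/connected_intervalP.
    apply => //; first by exists S => //; rewrite setTI.
    by exists S => //; rewrite setTI.
  by move/eqP : gb; apply; exact: nbhs_singleton SbT.
apply: (sub_countable _ (countable_isolated [set x | g x = 0])).
apply: subset_card_le => x /= gx0; split; first by rewrite inE.
have Sx : ~ S x by rewrite S0.
exists [set y | y != x -> g y != 0]; first exact: punct.
apply/seteqP; split => [y /= [yx gy]|y /= ->]; last by split=> //; rewrite eqxx.
by apply/eqP; apply: contraPT gy => /yx /eqP.
Qed.

End Dichotomy.

(** * Real-analytic functions of several variables *)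

Section Multivariate.
Variables (R : realType) (k : nat).
Implicit Types (f : 'cV[R]_k -> R) (p : 'cV[R]_k).

Let box (F : {ffun 'I_k -> nat} -> R) : nat -> R := fun N =>
  \sum_(b : {ffun 'I_k -> 'I_N}) F [ffun i => nat_of_ord (b i)].

Let single (j : 'I_k) (m : nat) : {ffun 'I_k -> nat} :=
  [ffun i => if i == j then m else 0%N].

Let box_single (j : 'I_k) (F : {ffun 'I_k -> nat} -> R) N :
  (forall (al : {ffun 'I_k -> nat}) i, i != j -> al i != 0%N -> F al = 0) ->
  box F N.+1 = \sum_(m < N.+1) F (single j m).
Proof.
move=> F0; rewrite /box.
rewrite (bigID (fun b : {ffun 'I_k -> 'I_N.+1} =>
  [forall i, (i != j) ==> (b i == ord0)]))/= [X in _ + X]big1 ?addr0; last first.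
  move=> b /forallPn[i]; rewrite negb_imply => /andP[ij bi].
  by apply: (F0 _ i) => //; rewrite ffunE.
pose h (m : 'I_N.+1) : {ffun 'I_k -> 'I_N.+1} :=
  [ffun i => if i == j then m else ord0].
rewrite (reindex_onto h (fun b => b j))/=; last first.
  move=> b /forallP bP; apply/ffunP => i; rewrite ffunE.
  by case: eqVneq => [->//|ij]; have := bP i; rewrite ij => /eqP.
apply: eq_big => m.
  rewrite !ffunE !eqxx andbT; apply/forallP => i; apply/implyP => ij.
  by rewrite ffunE (negPf ij).
by move=> _; congr F; apply/ffunP => i; rewrite !ffunE; case: eqP.
Qed.

(** On the line through [p] in direction [j] the other differences vanish, which kills every term
    with a positive exponent off [j]: box sums become ordinary partial sums. *)
Lemma real_analytic_slice f p (j : 'I_k) : real_analytic f ->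
  power_series_at (fun t => f (p + t *: delta_mx j 0)) 0.
Proof.
move=> /(_ p)[c] /=.
move=> /nbhs_ballP[r /= r_gt0 near_p0].
pose term (x : 'cV[R]_k) (al : {ffun 'I_k -> nat}) :=
  c al * \prod_i (x i 0 - p i 0) ^+ al i.
have near_p x : ball p r x ->
    cvgn (box (fun al => `|term x al|)) /\ box (term x) @ \oo --> f x.
  exact: near_p0.
pose x t := p + t *: delta_mx j 0 : 'cV[R]_k.
have x_near t : `|t| < r -> ball p r (x t).
  move=> tr; split=> // i l; rewrite /ball/= !mxE opprD addrA subrr sub0r normrN normrM.
  by case: (i == j); case: (l == 0); rewrite /= ?normr1 ?normr0 ?mulr1 ?mulr0.
have termE t (al : {ffun 'I_k -> nat}) : term (x t) al = c al * \prod_i (t * (i == j)%:R) ^+ al i.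
  by congr (_ * _); apply: eq_bigr => i _; rewrite !mxE eqxx andbT addrAC subrr add0r.
have term0 t (al : {ffun 'I_k -> nat}) i : i != j -> al i != 0%N -> term (x t) al = 0.
  move=> ij ali; rewrite termE (bigD1 i)//= (negPf ij) mulr0 expr0n.
  by rewrite (negPf ali) mul0r mulr0.
have term1 t m : term (x t) (single j m) = c (single j m) * t ^+ m.
  rewrite termE; congr (_ * _); rewrite (bigD1 j)//= ffunE eqxx mulr1.
  by rewrite big1 ?mulr1// => i /negPf ij; rewrite ffunE ij expr0.
have r2 : `|r / 2| < r.
  by rewrite ger0_norm ?divr_ge0 ?ltW// gtr_pMr// invf_lt1 ?ltr1n.
have r20 : 0 <= r / 2 by rewrite divr_ge0// ltW.
(* The absolute box sums at the point [t = r / 2] converge, hence are bounded, and the box of side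
   [m.+1] contains the term of degree [m] as its last one. *)
have [K cK] : exists K, forall m, `|c (single j m)| * (r / 2) ^+ m <= K.
  have [/cvg_seq_bounded + _] := near_p _ (x_near _ r2).
  move=> [M [Mreal MP]].
  have M1 : M < M + 1 by rewrite ltrDl.
  exists (M + 1) => m; have /= := MP _ M1 m.+1 I.
  apply: le_trans; rewrite (le_trans _ (ler_norm _))//.
  rewrite (@box_single j)//; last first.
    by move=> al i ij ali; rewrite (term0 _ _ i)// normr0.
  rewrite (bigD1 ord_max)//= term1 normrM normrX (ger0_norm r20).
  by rewrite lerDl sumr_ge0.
exists (fun m => c (single j m)), (r / 2), K; split=> //; first by rewrite divr_gt0.
move=> t tr; rewrite add0r.
have {}tr : `|t| < r by rewrite (lt_trans tr)// gtr_pMr// invf_lt1 ?ltr1n.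
have [_ ] := near_p _ (x_near _ tr); apply: cvg_trans; apply: near_eq_cvg.
exists 1%N => // -[//|N] _ /=; rewrite -/(box _ _) (@box_single j) => [|al i].
  by apply: eq_bigr => m _; rewrite term1.
exact: term0.
Qed.

(** Absolute convergence at one point [y], displaced from [p] by [rho] in every coordinate, with
    sums bounded by [M], controls a whole cube: if all displacements of [x] are at most [s * rho]
    with [s <= 1], each nonconstant term is at most [s] times its absolute value at [y]. So [f x] is
    within [s * M] of the constant term. *)
Lemma real_analytic_continuous f : real_analytic f -> continuous f.
Proof.
move=> fa p; have [c /=] := fa p.
move=> /nbhs_ballP[r /= r_gt0 near_p0].
pose term (x : 'cV[R]_k) (al : {ffun 'I_k -> nat}) :=
  c al * \prod_i (x i 0 - p i 0) ^+ al i.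
have near_p x : ball p r x ->
    cvgn (box (fun al => `|term x al|)) /\ box (term x) @ \oo --> f x.
  exact: near_p0.
have [rho [rho_gt0 rho_r]] : exists rho, 0 < rho /\ rho < r.
  by exists (r / 2); rewrite divr_gt0// gtr_pMr// invf_lt1 ?ltr1n.
pose y := p + const_mx rho : 'cV[R]_k.
have yr : ball p r y.
  split=> // i l; rewrite /ball/= !mxE opprD addrA subrr sub0r normrN.
  by rewrite ger0_norm// ltW.
have [M MP] : exists M, forall N, box (fun al => `|term y al|) N <= M.
  have [/cvg_seq_bounded + _] := near_p _ yr.
  move=> [M [Mreal MP]].
  have M1 : M < M + 1 by rewrite ltrDl.
  exists (M + 1) => N; have /= := MP _ M1 N I.
  by apply: le_trans; rewrite ler_norm.
pose al0 : {ffun 'I_k -> nat} := [ffun=> 0%N].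
have key (x : 'cV[R]_k) (s : R) : 0 <= s <= 1 -> (forall i, `|x i 0 - p i 0| <= s * rho) ->
    `|f x - c al0| <= s * M.
  move=> /andP[s0 s1] xs.
  have xr : ball p r x.
    split=> // i l; rewrite /ball/= ord1 distrC (le_lt_trans (xs i))//.
    by rewrite (le_lt_trans _ rho_r)// ler_piMl// ltW.
  have [_ h] := near_p _ xr.
  have {}h : `|box (term x) N - c al0| @[N --> \oo] --> `|f x - c al0|.
    by apply: cvg_norm; apply: cvgB; [exact: h|exact: cvg_cst].
  rewrite -(cvg_lim _ h)//; apply: limr_le; first by apply/cvg_ex; eexists; exact: h.
  exists 1%N => // -[//|N] _ /=.
  pose b0 : {ffun 'I_k -> 'I_N.+1} := [ffun=> ord0].
  have b0E : [ffun i => nat_of_ord (b0 i)] = al0 by apply/ffunP => i; rewrite !ffunE.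
  have t0E z : term z al0 = c al0.
    by rewrite /term big1 ?mulr1// => i _; rewrite ffunE expr0.
  rewrite /box (bigD1 b0)//= b0E t0E addrAC subrr add0r.
  rewrite (le_trans (ler_norm_sum _ _ _))//.
  apply: (@le_trans _ _ (s * box (fun al => `|term y al|) N.+1)); last first.
    by rewrite ler_wpM2l.
  rewrite /box mulr_sumr [leRHS](bigD1 b0)//= ler_wpDl ?mulr_ge0//.
  apply: ler_sum => b bb0.
  have [i bi] : exists i, b i != ord0.
    apply/existsP; apply: contraNT bb0 => /existsPn b00; apply/eqP/ffunP => i.
    by rewrite ffunE; apply/eqP/negPn/b00.
  rewrite /term !normrM mulrCA ler_wpM2l// !normr_prod.
  (* The coordinate [i] with a positive exponent provides the factor [s]; the other coordinates are
     bounded by their values at [y]. *)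
  rewrite (bigD1 i)//= [in leRHS](bigD1 i)//= mulrA.
  have yE l : y l 0 - p l 0 = rho by rewrite !mxE addrAC subrr add0r.
  apply: ler_pM => //; first by rewrite prodr_ge0.
    rewrite normrX ffunE yE normrX (ger0_norm (ltW rho_gt0)).
    apply: (@le_trans _ _ ((s * rho) ^+ b i)); first by rewrite lerXn2r ?nnegrE ?mulr_ge0// ltW.
    rewrite exprMn ler_wpM2r ?exprn_ge0 ?(ltW rho_gt0)// -[leRHS]expr1.
    by rewrite ler_wiXn2l// lt0n; apply: contra bi => /eqP bi0; apply/eqP/val_inj.
  apply: ler_prod => l _; rewrite normr_ge0/= !normrX yE lerXn2r ?nnegrE//.
  rewrite (ger0_norm (ltW rho_gt0)) (le_trans (xs l))// ler_piMl// ltW//.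
(* The case [s = 0] of the estimate. *)
have fp : f p = c al0.
  apply/eqP; rewrite -subr_eq0 -normr_le0 -(mul0r M); apply: key; first by rewrite lexx/=.
  by move=> i; rewrite subrr normr0 mul0r.
apply/(@cvgrPdist_lt _ _ _ (nbhs p) (nbhs_filter p)) => e e0.
have M0 : 0 <= M by rewrite (le_trans _ (MP 0%N))// sumr_ge0.
pose s := Num.min 1 (e / (2 * (M + 1))).
have M1 : 0 < M + 1 by rewrite ltr_wpDl.
have s_gt0 : 0 < s by rewrite lt_min ltr01 divr_gt0// mulr_gt0.
have srho : 0 < s * rho by rewrite mulr_gt0.
apply/nbhs_ballP; exists (s * rho) => // x px.
rewrite distrC fp; apply: (@le_lt_trans _ _ (s * M)).
  apply: key; first by rewrite ltW//= /s ge_min lexx.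
  by move=> i; rewrite distrC ltW//; case: px => _; exact.
apply: (@le_lt_trans _ _ (e / (2 * (M + 1)) * M)).
  by rewrite ler_wpM2r// /s ge_min lexx orbT.
by rewrite mulrAC ltr_pdivrMr ?mulr_gt0// ltr_pM2l//; lra.
Qed.

End Multivariate.

(** * Zero sets of analytic functions of independent variables *)

Section CountableDiscretization.
Variables (R : realType) (k : nat).

Let grid (N : nat) (x : 'cV[R]_k) : {ffun 'I_k -> int} :=
  [ffun i => Num.floor (N.+1%:R * x i 0)].

Let grid_point (N : nat) (m : {ffun 'I_k -> int}) : 'cV[R]_k :=
  \col_i (N.+1%:R^-1 * (m i)%:~R).

Let grid_point_cvg (x : 'cV[R]_k) : grid_point N (grid N x) @[N --> \oo] --> x.
Proof.
apply/cvg_ballP => e e0; near=> N.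
split=> // i j; rewrite /ball/= ord1 !mxE ffunE.
set y := N.+1%:R * _.
have -> : x i 0 = N.+1%:R^-1 * y by rewrite /y mulKf// pnatr_eq0.
rewrite -mulrBr normrM ger0_norm ?invr_ge0//.
apply: (@le_lt_trans _ _ (N.+1%:R^-1)).
  rewrite ler_piMr ?invr_ge0// ger0_norm ?subr_ge0 ?floor_le_tmp//.
  by rewrite lerBlDl -intrD1 ltW// floorD1_gt.
by near: N; exact: (near_infty_natSinv_lt (PosNum e0)).
Unshelve. all: by end_near. Qed.

(* [f (X w)] is the limit of [f] at grid points near [X w], which takes
   countably many values; no sigma-algebra on column vectors is needed. *)
Lemma continuous_coord_measurable d (T : measurableType d) (f : 'cV[R]_k -> R)
    (X : T -> 'cV[R]_k) : continuous f ->
  (forall i, measurable_fun setT (fun w => X w i 0)) ->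
  measurable_fun setT (fun w => f (X w)).
Proof.
move=> cf mX.
apply: (@measurable_fun_cvg _ _ _ setT (fun N w => f (grid_point N (grid N (X w))))).
  move=> N _ B mB; rewrite setTI.
  pose E n : set T := if unpickle n is Some m then
    if `[< B (f (grid_point N m)) >] then [set w | grid N (X w) = m] else set0
    else set0.
  rewrite (_ : _ @^-1` _ = \bigcup_n E n); last first.
    apply/seteqP; split => [w /= Bw|w [n _]].
      by exists (pickle (grid N (X w))) => //; rewrite /E pickleK asboolT.
    rewrite /E; case: unpickle => // m; case: asboolP => // Bm /= wm.
    by rewrite /preimage/= wm.
  apply: bigcupT_measurable => n; rewrite /E; case: unpickle => // m.
  case: ifP => // _.
  rewrite (_ : mkset _ = \bigcap_(i in [set: 'I_k])
      ((fun w => N.+1%:R * X w i 0) @^-1` `[(m i)%:~R, (m i + 1)%:~R[)); last first.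
    apply/seteqP; split => w /=.
      by move=> <- i _; rewrite /= in_itv/= ffunE floor_le_tmp floorD1_gt.
    move=> h; apply/ffunP => i; rewrite ffunE; apply: floor_def.
    by have := h i I; rewrite /= in_itv.
  apply: fin_bigcap_measurable => [|i _]; first exact: finite_finset.
  rewrite -[X in measurable X]setTI.
  by apply: (measurable_funM (measurable_cst _) (mX i)) => //; exact: measurable_itv.
move=> w _; have h := cvg_comp _ _ (@grid_point_cvg (X w)) (cf (X w)).
exact: h.
Qed.

End CountableDiscretization.

Lemma power_series_nonzero_ae (R : realType) d (T : measurableType d)
    (P : probability T R) (k : nat)
    (mu : 'I_k -> probability (measurableTypeR R) R) (X : T -> 'cV[R]_k)
    (f : 'cV[R]_k -> R) (a : 'cV[R]_k) :
  (forall i A, countable A -> mu i A = 0%E) ->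
  (forall i, measurable_fun setT (fun w => X w i 0)) ->
  (forall B : 'I_k -> set R, (forall i, measurable (B i)) ->
    P [set w | forall i, B i (X w i 0)] = (\prod_i mu i (B i))%E) ->
  continuous f ->
  (forall p j t, power_series_at (fun s => f (p + s *: delta_mx j 0)) t) ->
  f a != 0 -> P [set w | f (X w) = 0] = 0%E.
Proof.
move=> mu0 mX PX cf sf fa.
(* [Y j] has the first [j] coordinates of [X] and the remaining ones of [a]. *)
pose Y (j : nat) w : 'cV[R]_k := \col_i (if (i < j)%N then X w i 0 else a i 0).
suff S : forall j, (j <= k)%N -> P [set w | f (Y j w) = 0] = 0%E.
  rewrite -(S k (leqnn k)); congr (P _); apply/seteqP; split => w /=;
    by rewrite (_ : Y k w = X w)//; apply/matrixP => i l; rewrite !mxE ltn_ord ord1.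
elim=> [_|j IH jk].
  rewrite (_ : mkset _ = set0) ?measure0//; apply/seteqP; split => // w /=.
  rewrite (_ : Y _ _ = a); first exact/eqP.
  by apply/matrixP => i l; rewrite !mxE ord1.
have {}IH := IH (ltnW jk).
pose i0 : 'I_k := Ordinal jk.
(* [Z] frees coordinate [j] as a real variable: the value [a i0 0] gives back [Y j], and the value
   [X w i0 0] gives [Y j.+1]. *)
pose Z (z : T * R) : 'cV[R]_k :=
  \col_i (if (i < j)%N then X z.1 i 0 else if i == i0 then z.2 else a i 0).
pose D := [set z : T * measurableTypeR R | f (Z z) = 0].
(* The law of the pair [(w, X w i0 0)] is carried by a graph and is not the product measure on all
   measurable sets. The two agree on the sigma-algebra generated by these rectangles, which see [w]
   only through its first [j] coordinates; [D] must therefore be shown measurable for that smaller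
   sigma-algebra. *)
pose rect (B : 'I_k -> set R) (C : set R) : set (T * measurableTypeR R) :=
  [set z | (forall i : 'I_k, (i < j)%N -> B i (X z.1 i 0)) /\ C z.2].
pose G := [set A | exists B C, [/\ forall i, measurable (B i), measurable C &
   A = rect B C]].
have mrect1 (B : 'I_k -> set R) : (forall i, measurable (B i)) ->
    measurable [set w : T | forall i : 'I_k, (i < j)%N -> B i (X w i 0)].
  move=> mB; rewrite (_ : mkset _ = \bigcap_(i in [set i : 'I_k | (i < j)%N])
    ((fun w => X w i 0) @^-1` (B i))) //.
  apply: fin_bigcap_measurable => [|i _]; first exact: finite_finset.
  by rewrite -[X in measurable X]setTI; exact: mX.
have rectE B C : rect B C =
    [set w | forall i : 'I_k, (i < j)%N -> B i (X w i 0)] `*` C by [].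
have Gm : G `<=` measurable.
  by move=> _ [B [C [mB mC ->]]]; rewrite rectE; apply: measurableX => //; exact: mrect1.
have GI : setI_closed G.
  move=> _ _ [B [C [mB mC ->]]] [B' [C' [mB' mC' ->]]].
  exists (fun i => B i `&` B' i), (C `&` C'); split.
  - by move=> i; exact: measurableI.
  - exact: measurableI.
  - apply/seteqP; split => z /=.
      by move=> [[h1 h2] [h3 h4]]; split=> // i ij; split; [exact: h1|exact: h3].
    by move=> [h1 [h2 h3]]; split; split=> // i ij; have [] := h1 i ij.
pose T' := g_sigma_algebraType G.
have mZ : measurable_fun [set: T'] (fun z : T' => f (Z z)).
  apply: continuous_coord_measurable => // i.
  have [ij|ij] := ltnP i j.
    rewrite (_ : (fun _ => _) = (fun z : T' => X z.1 i 0)); last first.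
      by apply/funext => z; rewrite mxE ij.
    move=> _ B mB; rewrite setTI; apply: sub_sigma_algebra.
    exists (fun l => if l == i then B else setT), setT; split=> //.
      by move=> l; case: ifP.
    apply/seteqP; split => z /=.
      by move=> Bz; split=> // l _; case: eqP => // ->.
    by move=> [/(_ i ij)]; rewrite eqxx.
  have [ii0|ii0] := eqVneq i i0; last first.
    rewrite (_ : (fun _ => _) = cst (a i 0)); first exact: measurable_cst.
    by apply/funext => z; rewrite mxE ltnNge ij (negPf ii0).
  rewrite (_ : (fun _ => _) = (fun z : T' => z.2)); last first.
    by apply/funext => z; rewrite mxE ltnNge ij ii0 eqxx.
  move=> _ B mB; rewrite setTI; apply: sub_sigma_algebra.
  exists (fun l => setT), B; split=> //.
  by apply/seteqP; split => z //= [].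
have GD : <<s G >> D.
  have := mZ measurableT [set 0] (measurable_set1 _).
  by rewrite setTI.
have mD : measurable D by move: GD; apply: smallest_sub => //; exact: sigma_algebra_measurable.
have mgraph : measurable_fun setT (fun w => (w, X w i0 0) : T * measurableTypeR R).
  by apply/measurable_fun_pair => //; exact: mX.
have m12 : (P \x mu i0)%E D =
    pushforward P (fun w => (w, X w i0 0) : T * measurableTypeR R) D.
  apply: (g_sigma_algebra_measure_unique G Gm (fun=> setT) _ _
    (P \x mu i0)%E (pushforward P _)) => //.
  - move=> _; exists (fun=> setT), setT; split=> //.
    by apply/seteqP; split.
  - by apply/seteqP; split => // z _; exists 0%N.
  - move=> _ [B [C [mB mC ->]]].
    (* The product formula is applied twice: with [B'], where coordinate [i0] is unconstrained, and
       with [B''], where it is constrained by [C]. The two products differ by the factor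
       [mu i0 C]. *)
    pose B' (i : 'I_k) := if (i < j)%N then B i else setT.
    pose B'' (i : 'I_k) := if i == i0 then C else B' i.
    have mB' i : measurable (B' i) by rewrite /B'; case: ifP.
    have mB'' i : measurable (B'' i) by rewrite /B''; case: ifP.
    pose S := [set w | forall i : 'I_k, (i < j)%N -> B i (X w i 0)].
    rewrite rectE; transitivity (P S * mu i0 C)%E.
      by apply: product_measure1E => //; exact: mrect1.
    have -> : S =
        [set w | forall i, B' i (X w i 0)].
      apply/seteqP; split => w /= h i; first by rewrite /B'; case: ifP => // /h.
      by move=> ij; have := h i; rewrite /B' ij.
    rewrite PX//; transitivity (P [set w | forall i, B'' i (X w i 0)]); last first.
      congr (P _); apply/seteqP; split => w /=; last first.
        move=> [h1 h2] i; rewrite /B'' /B'; case: eqP => [->//|_].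
        by case: ifP => // /h1.
      move=> h; split=> [i ij|]; last by have := h i0; rewrite /B'' eqxx.
      have := h i; rewrite /B'' /B' ij; case: eqP => // ii0.
      by move: ij; rewrite ii0 /= ltnn.
    rewrite PX// [in LHS](bigD1 i0)//= [in RHS](bigD1 i0)//=.
    rewrite /B'' eqxx [X in mu i0 X](_ : B' i0 = setT); last by rewrite /B' /= ltnn.
    rewrite probability_setT mul1e muleC; congr (_ * _)%E.
    by apply: eq_bigr => i /negPf ->.
  - by move=> _; rewrite -setXTT [ltLHS]product_measure1E//= !probability_setT mule1 ltry.
rewrite (_ : [set w | _] = (fun w => (w, X w i0 0) : T * measurableTypeR R) @^-1` D).
  transitivity ((P \x mu i0)%E D); first by rewrite m12.
  rewrite /product_measure1 -(integral0 P setT).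
  apply: ae_eq_integral => //.
    by apply: measurable_fun_xsection.
  have mYj : measurable [set w | f (Y j w) = 0].
    suff h : measurable_fun setT (fun w => f (Y j w)).
      by have := h measurableT [set 0] (measurable_set1 _); rewrite setTI.
    apply: continuous_coord_measurable => // i.
    have [ij|ij] := ltnP i j.
      rewrite (_ : (fun _ => _) = (fun w => X w i 0)); first exact: mX.
      by apply/funext => w; rewrite mxE ij.
    rewrite (_ : (fun _ => _) = cst (a i 0)); first exact: measurable_cst.
    by apply/funext => w; rewrite mxE ltnNge ij.
  exists [set w | f (Y j w) = 0]; split=> // w /= /not_implyP[_ /eqP h].
  apply: contrapT => /eqP fY; move/eqP : h; apply => /=.
  apply: mu0.
  (* Base point of the line swept by the free coordinate. This line passes through [Y j w], where
     [f] is nonzero, so the section of [D] is a countable zero set. *)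
  pose p := Y j w - (a i0 0) *: delta_mx i0 0.
  have Zp s : Z (w, s) = p + s *: delta_mx i0 0.
    apply/matrixP => i l; rewrite !mxE ord1 eqxx andbT.
    case: eqVneq => [->|ii0]; first by rewrite /= ltnn !mulr1 subrr add0r.
    by rewrite !mulr0 subr0 addr0.
  have fpa : f (p + a i0 0 *: delta_mx i0 0) != 0 by rewrite /p subrK.
  apply: (sub_countable _ (power_series_zeros_countable (sf p i0) fpa)).
  apply: subset_card_le => s; rewrite /xsection/= inE /D/= => <-.
  by rewrite Zp.
have YZ w : Y j.+1 w = Z (w, X w i0 0).
  apply/matrixP => i l; rewrite !mxE /= ltnS leq_eqVlt.
  by have [->|] := eqVneq i i0; rewrite ?eqxx ?ltnn//= -val_eqE/= => /negPf ->.
by apply/seteqP; split => w; rewrite /D/= YZ.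
Qed.

(** * The Gram determinant under Gaussian noise *)

Section ClosedClass.
Variables (R : realType) (V : Type) (C : (V -> R) -> Prop).
Hypothesis C_cst : forall a, C (cst a).
Hypothesis C_add : forall f g, C f -> C g -> C (fun v => f v + g v).
Hypothesis C_mul : forall f g, C f -> C g -> C (fun v => f v * g v).

Let C_sum (I : Type) (r : seq I) (F : I -> V -> R) :
  (forall i, C (F i)) -> C (fun v => \sum_(i <- r) F i v).
Proof.
move=> CF; elim: r => [|i r IH].
  by under eq_fun do rewrite big_nil; exact: C_cst.
by under eq_fun do rewrite big_cons; exact: C_add.
Qed.

Let C_prod (I : Type) (r : seq I) (F : I -> V -> R) :
  (forall i, C (F i)) -> C (fun v => \prod_(i <- r) F i v).
Proof.
move=> CF; elim: r => [|i r IH].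
  by under eq_fun do rewrite big_nil; exact: C_cst.
by under eq_fun do rewrite big_cons; exact: C_mul.
Qed.

(** The determinant is a polynomial in the entries. The class [C] is abstract so that one argument
    serves both continuity and power series along a line. *)
Lemma gram_det_closed (n m : nat) (A : V -> 'M[R]_(n, m)) :
  (forall i j, C (fun v => A v i j)) ->
  C (fun v => \det (augment (A v) *m (augment (A v))^T)).
Proof.
move=> CA.
have Caug i j : C (fun v => augment (A v) i j).
  case: (split_ordP j) => l ->.
    by under eq_fun do rewrite row_mxEl.
  by under eq_fun do rewrite row_mxEr mxE; exact: C_cst.
apply: C_sum => s; apply: C_mul; first exact: C_cst.
apply: C_prod => i; under eq_fun do rewrite mxE.
apply: C_sum => j; apply: C_mul => //.
by under eq_fun do rewrite mxE.
Qed.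

End ClosedClass.

Lemma normal_prob_countable (R : realType) (s : R) (A : set R) : s != 0 ->
  countable A -> normal_prob 0 s A = 0%E.
Proof.
move=> s0 cA.
have mA : measurable (A : set (measurableTypeR R)).
  by apply: countable_measurable => // t; exact: measurable_set1.
have /null_content_dominatesP := normal_prob_dominates 0 s.
by apply => //; exact: countable_lebesgue_measure0.
Qed.

Lemma block_gaussian_coord (R : realType) d (T : measurableType d)
    (P : probability T R) (H : nat) (dim : 'I_H -> nat) (sigma : 'I_H -> R)
    (delta : T -> 'cV[R]_(\sum_(l < H) dim l)%N)
    (B : 'I_(\sum_(l < H) dim l) -> set R) :
  block_gaussian P sigma delta -> (forall i, measurable (B i)) ->
  P [set w | forall i, B i (delta w i 0)] =
  (\prod_i normal_prob 0 (sigma (tagnat.sig1 i)) (B i))%E.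
Proof.
move=> [_ gd] mB.
have := gd (fun l j => B (tagnat.Rank l j)) (fun l j => mB _).
rewrite (_ : [set _ | _] = [set w | forall i, B i (delta w i 0)]); last first.
  apply/seteqP; split => w /= h.
    by move=> i; have := h (tagnat.sig1 i) (tagnat.sig2 i); rewrite mxE tagnat.sig2K.
  by move=> l j; rewrite mxE.
move=> ->; rewrite sig_big_dep/= [RHS](reindex tagnat.rank)/=; last first.
  exact: tagnat.rank_bij_on.
by apply: eq_big => // -[l j] _; rewrite tagnat.rankE/= tagnat.Rank1K.
Qed.

Lemma expressivity_ae (R : realType) d (T : measurableType d)
    (P : probability T R) (H n mH : nat) (dim : 'I_H -> nat) (sigma : 'I_H -> R)
    (delta : T -> 'cV[R]_(\sum_(l < H) dim l)%N)
    (hX : 'cV[R]_(\sum_(l < H) dim l)%N -> 'M[R]_(n, mH))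
    (u : 'cV[R]_(\sum_(l < H) dim l)%N) :
  (forall l, 0 < sigma l) -> block_gaussian P sigma delta ->
  (forall i j, real_analytic (fun u => hX u i j)) ->
  (exists u, expressivity_det hX u != 0) ->
  {ae P, forall z, expressivity_det hX (u + delta z) != 0}.
Proof.
move=> sigma_gt0 gd hA [a0 ha0].
pose f v := expressivity_det hX (u + v).
have cf : continuous f.
  have ch : continuous (expressivity_det hX).
    apply: (@gram_det_closed _ _ (fun g : _ -> R => continuous g)).
    - by move=> a; exact: cst_continuous.
    - by move=> g1 g2 c1 c2 v; exact: (cvgD (c1 v) (c2 v)).
    - by move=> g1 g2 c1 c2 v; exact: (cvgM (c1 v) (c2 v)).
    - by move=> i j; exact: real_analytic_continuous.
  move=> v; apply: (@cvg_comp _ _ _ (fun v => u + v) (expressivity_det hX)); last exact: ch.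
  exact: (cvgD (cvg_cst u) (@cvg_id _ (nbhs v))).
have sf p j t : power_series_at (fun s => f (p + s *: delta_mx j 0)) t.
  apply: (@gram_det_closed _ _ (fun g => power_series_at g t)
    _ _ _ _ _ (fun s => hX (u + (p + s *: delta_mx j 0)))).
  - by move=> a; exact: power_series_at_cst.
  - by move=> g1 g2; exact: power_series_at_add.
  - by move=> g1 g2; exact: power_series_at_mul.
  - move=> i l.
    (* Slices expand at parameter 0; moving the base point along the line recentres the expansion at
       [t]. *)
    have [c [r [K [r0 cK cg]]]] :=
      real_analytic_slice (u + (p + t *: delta_mx j 0)) j (hA i l).
    exists c, r, K; split=> // s sr; have := cg s sr.
    by rewrite add0r -!addrA -scalerDl.
have fa : f (a0 - u) != 0 by rewrite /f addrC subrK.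
pose mu (i : 'I_(\sum_(l < H) dim l)) : probability (measurableTypeR R) R :=
  normal_prob 0 (sigma (tagnat.sig1 i)).
have mdelta := gd.1.
exists [set z | f (delta z) = 0]; split.
- have mfd : measurable_fun setT (fun z => f (delta z)).
    exact: continuous_coord_measurable.
  by have := mfd measurableT [set 0] (measurable_set1 _); rewrite setTI.
- apply: (@power_series_nonzero_ae _ _ _ P _ mu delta f _ _ _ _ _ _ fa) => //.
    by move=> i A cA; apply: normal_prob_countable => //; rewrite gt_eqF.
  by move=> B mB; exact: block_gaussian_coord.
- by move=> z /= /negP/negPn/eqP.
Qed.

(** * Euclidean geometry, convexity and smoothness *)

Section Euclid.
Variable R : realType.

Definition dot (k : nat) (x y : 'cV[R]_k) : R := \sum_i x i 0 * y i 0.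

Lemma sqnorm2_cV (k : nat) (x : 'cV[R]_k) : sqnorm2 x = \sum_i x i 0 ^+ 2.
Proof. by apply: eq_bigr => i _; rewrite big_ord1. Qed.

Lemma dotxx (k : nat) (x : 'cV[R]_k) : dot x x = sqnorm2 x.
Proof. by rewrite sqnorm2_cV; apply: eq_bigr => i _; rewrite expr2. Qed.

Lemma dotC (k : nat) (x y : 'cV[R]_k) : dot x y = dot y x.
Proof. by apply: eq_bigr => i _; rewrite mulrC. Qed.

Lemma dotDl (k : nat) (x y z : 'cV[R]_k) : dot (x + y) z = dot x z + dot y z.
Proof. by rewrite -big_split; apply: eq_bigr => i _; rewrite mxE mulrDl. Qed.

Lemma dotZl (k : nat) a (x y : 'cV[R]_k) : dot (a *: x) y = a * dot x y.
Proof. by rewrite mulr_sumr; apply: eq_bigr => i _; rewrite mxE mulrA. Qed.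

Lemma dotNl (k : nat) (x y : 'cV[R]_k) : dot (- x) y = - dot x y.
Proof. by rewrite -scaleN1r dotZl mulN1r. Qed.

Lemma dot0l (k : nat) (x : 'cV[R]_k) : dot 0 x = 0.
Proof. by rewrite /dot big1// => i _; rewrite mxE mul0r. Qed.

Lemma dotDr (k : nat) (x y z : 'cV[R]_k) : dot x (y + z) = dot x y + dot x z.
Proof. by rewrite dotC dotDl !(dotC x). Qed.

Lemma dotZr (k : nat) a (x y : 'cV[R]_k) : dot x (a *: y) = a * dot x y.
Proof. by rewrite dotC dotZl dotC. Qed.

Lemma dotNr (k : nat) (x y : 'cV[R]_k) : dot x (- y) = - dot x y.
Proof. by rewrite dotC dotNl dotC. Qed.

Lemma sqnorm2_ge0 (m k : nat) (A : 'M[R]_(m, k)) : 0 <= sqnorm2 A.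
Proof. by apply: sumr_ge0 => i _; apply: sumr_ge0 => j _; exact: sqr_ge0. Qed.

Lemma norm2_sqr (m k : nat) (A : 'M[R]_(m, k)) : norm2 A ^+ 2 = sqnorm2 A.
Proof. by rewrite sqr_sqrtr// sqnorm2_ge0. Qed.

Lemma norm2_ge0 (m k : nat) (A : 'M[R]_(m, k)) : 0 <= norm2 A.
Proof. exact: sqrtr_ge0. Qed.

Lemma sqnorm20 (k : nat) : sqnorm2 (0 : 'cV[R]_k) = 0.
Proof. by rewrite -dotxx dot0l. Qed.

Lemma sqnorm2_eq0 (k : nat) (x : 'cV[R]_k) : sqnorm2 x = 0 -> x = 0.
Proof.
rewrite sqnorm2_cV => /eqP; rewrite psumr_eq0 => [/allP h|i _]; last exact: sqr_ge0.
apply/matrixP => i j; rewrite ord1 mxE; apply/eqP.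
by have := h i; rewrite mem_index_enum sqrf_eq0 => /(_ isT).
Qed.

Lemma sqnorm2N (k : nat) (x : 'cV[R]_k) : sqnorm2 (- x) = sqnorm2 x.
Proof. by rewrite !sqnorm2_cV; apply: eq_bigr => i _; rewrite mxE sqrrN. Qed.

Lemma sqnorm2D (k : nat) (x y : 'cV[R]_k) :
  sqnorm2 (x + y) = sqnorm2 x + 2 * dot x y + sqnorm2 y.
Proof.
rewrite !sqnorm2_cV /dot mulr_sumr -!big_split/=; apply: eq_bigr => i _.
by rewrite mxE sqrrD mulr_natl.
Qed.

Lemma sqnorm2Z (k : nat) a (x : 'cV[R]_k) : sqnorm2 (a *: x) = a ^+ 2 * sqnorm2 x.
Proof.
by rewrite !sqnorm2_cV mulr_sumr; apply: eq_bigr => i _; rewrite mxE exprMn.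
Qed.

Lemma norm2Z (k : nat) a (x : 'cV[R]_k) : norm2 (a *: x) = `|a| * norm2 x.
Proof. by rewrite /norm2 sqnorm2Z sqrtrM ?sqr_ge0// sqrtr_sqr. Qed.

(** Cauchy-Schwarz, from the nonnegative square of [sqnorm2 y *: x - dot x y *: y]. *)
Lemma dot_sqr_le (k : nat) (x y : 'cV[R]_k) :
  dot x y ^+ 2 <= sqnorm2 x * sqnorm2 y.
Proof.
have [y0|y0] := eqVneq (sqnorm2 y) 0.
  rewrite (sqnorm2_eq0 y0) /dot big1 ?expr0n ?mulr_ge0 ?sqnorm2_ge0// => i _.
  by rewrite mxE mulr0.
have ypos : 0 < sqnorm2 y by rewrite lt_neqAle eq_sym y0 sqnorm2_ge0.
have := sqnorm2_ge0 (sqnorm2 y *: x + - (dot x y *: y)).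
rewrite sqnorm2D sqnorm2N !sqnorm2Z dotNr dotZl dotZr.
rewrite [X in 0 <= X](_ : _ = sqnorm2 y * (sqnorm2 x * sqnorm2 y - dot x y ^+ 2)).
  by rewrite pmulr_rge0// subr_ge0.
by ring.
Qed.

Lemma dot_le_norm2 (k : nat) (x y : 'cV[R]_k) : dot x y <= norm2 x * norm2 y.
Proof.
rewrite /norm2 -sqrtrM ?sqnorm2_ge0// (le_trans (ler_norm _))// -sqrtr_sqr.
by rewrite ler_wsqrtr// dot_sqr_le.
Qed.

End Euclid.

Section Gradient.
Variables (R : realType) (k : nat).
Implicit Types (f : 'cV[R]_k -> R) (x d : 'cV[R]_k).

Lemma derive_gradient f x d : differentiable f x -> 'D_d f x = dot (gradient f x) d.
Proof.
move=> df; rewrite deriveE//.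
have {1}-> : d = \sum_i d i 0 *: delta_mx i 0.
  apply/matrixP => i j; rewrite ord1 summxE (bigD1 i)//= !mxE !eqxx mulr1.
  by rewrite big1 ?addr0// => l li; rewrite !mxE eq_sym (negPf li) mulr0.
rewrite linear_sum/=; apply: eq_bigr => i _.
by rewrite linearZ/= mxE deriveE// mulrC.
Qed.

Lemma is_derive_line f x d (t : R) : differentiable f (t *: d + x) ->
  is_derive t 1 (fun s => f (s *: d + x)) ('D_d f (t *: d + x)).
Proof.
move=> df.
have E : (fun h => h^-1 *: (((fun s => f (s *: d + x)) \o shift t) (h *: 1) -
      f (t *: d + x))) =
    (fun h => h^-1 *: ((f \o shift (t *: d + x)) (h *: d) - f (t *: d + x))).
  apply/funext => h /=; congr (_ *: (f _ - _)).
  by rewrite addrA -scalerDl /GRing.scale/= mulr1.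
split.
  by rewrite /derivable E; apply: diff_derivable.
by rewrite /derive E.
Qed.

(** Convexity bounds every difference quotient from [x] towards [y], with step [h] in (0, 1], by
    [f y - f x]; a larger derivative would be exceeded by no such quotient near 0. *)
Lemma convex_gradient_le f x y : convex_function setT f -> differentiable f x ->
  f x + dot (gradient f x) (y - x) <= f y.
Proof.
move=> cf df; rewrite -derive_gradient// addrC -lerBrDr leNgt; apply/negP => lt.
have : derivable f x (y - x) by exact: diff_derivable.
move/cvgr_gt => /(_ _ lt); rewrite /dnbhs /within/= => /nbhs_ballP[e /= e0 eP].
pose h := Num.min (e / 2) 1.
have h0 : 0 < h by rewrite lt_min divr_gt0/=.
have h1 : h <= 1 by rewrite ge_min lexx orbT.
have he : ball 0 e h.
  rewrite /ball/= sub0r normrN gtr0_norm// gt_min gtr_pMr//.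
  by rewrite invf_lt1 ?ltr1n.
have := eP h he (lt0r_neq0 h0); apply/negP; rewrite -leNgt /=.
have -> : h *: (y - x) + x = h *: y + (1 - h) *: x.
  by rewrite scalerBr scalerBl scale1r addrAC -addrA.
rewrite /GRing.scale/= mulrC ler_pdivrMr//.
have := cf (Itv01 (ltW h0) h1) y x; rewrite !inE => /(_ I I).
rewrite convRE /= (_ : unstable.onem h = 1 - h)// => cfxy.
have -> : h *: y + (1 - h) *: x = conv (Itv01 (ltW h0) h1) (y : convex_lmodType _) x by [].
by rewrite lerBlDr (le_trans cfxy)// le_eqVlt; apply/orP; left; apply/eqP; ring.
Qed.

(** Mean value theorem for [psi], the restriction of [f] to the segment minus its quadratic bound:
    the Lipschitz inequality makes the derivative of [psi] nonpositive. [M] may have either sign;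
    [nonpos_lipschitz_cst] uses [M <= 0]. *)
Lemma descent f (M : R) x y : (forall z, differentiable f z) ->
  (forall z z', norm2 (gradient f z - gradient f z') <= M * norm2 (z - z')) ->
  f y <= f x + dot (gradient f x) (y - x) + M / 2 * sqnorm2 (y - x).
Proof.
move=> df lip; set d := y - x.
pose c := dot (gradient f x) d; pose s := sqnorm2 d.
pose psi (t : R) := f (t *: d + x) - (t * c + M / 2 * s * t ^+ 2).
have dpsi (t : R) : is_derive t (1 : R) psi (dot (gradient f (t *: d + x)) d - (c + M * s * t)).
  apply: is_deriveB.
    by rewrite -derive_gradient//; exact: is_derive_line.
  apply: is_derive_eq.
  rewrite /GRing.scale/= !mulr1 mulr0 add0r.
  by field.
have : exists2 t, t \in `]0, 1[%R &
    psi 1 - psi 0 = (dot (gradient f (t *: d + x)) d - (c + M * s * t)) * (1 - 0).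
  apply: MVT => //.
  by apply: derivable_within_continuous => t _; have [] := dpsi t.
move=> [t]; rewrite in_itv/= => /andP[t0 t1]; rewrite subr0 mulr1 => E.
have : psi 1 - psi 0 <= 0.
  rewrite E opprD addrA subr_le0 /c -dotNl -dotDl (le_trans (dot_le_norm2 _ _))//.
  apply: (@le_trans _ _ (M * norm2 (t *: d + x - x) * norm2 d)).
    by rewrite ler_wpM2r// norm2_ge0.
  rewrite addrK norm2Z (ger0_norm (ltW t0)).
  rewrite /s -(norm2_sqr d) le_eqVlt; apply/orP; left; apply/eqP; ring.
rewrite /psi scale1r scale0r add0r /d subrK -/d subr_le0 => h.
rewrite -/c -/s; move: h; rewrite expr1n expr0n mul0r !mulr1 mulr0 mul1r; lra.
Qed.

End Gradient.

(** * The objective as a function of the last layer *)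

Lemma cvg_sumr (R : realType) (T I : Type) (F : set_system T) {FF : Filter F}
    (r : seq I) (f : I -> T -> R) (a : I -> R) :
  (forall i, f i x @[x --> F] --> a i) ->
  \sum_(i <- r) f i x @[x --> F] --> \sum_(i <- r) a i.
Proof.
move=> fa; elim: r => [|i r IH].
  by rewrite big_nil; under eq_fun do rewrite big_nil; exact: cvg_cst.
by rewrite big_cons; under eq_fun do rewrite big_cons; apply: cvgD.
Qed.

Section LastLayer.
Variables (R : realType) (n mH my : nat) (B : 'M[R]_(n, mH + 1)).
Implicit Types (v d : 'cV[R]_(my * (mH + 1))).

Definition output (i : 'I_n) v : 'cV[R]_my := (row i (B *m last_matrix v))^T.

Lemma outputE i v j l :
  output i v j l = \sum_s B i s * v (mxvec_index j s) 0.
Proof. by rewrite !mxE; apply: eq_bigr => s _; rewrite !mxE. Qed.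

Lemma outputD i v d : output i (v + d) = output i v + output i d.
Proof.
apply/matrixP => j l; rewrite [RHS]mxE !outputE -big_split/=.
by apply: eq_bigr => s _; rewrite mxE mulrDr.
Qed.

Lemma outputZ i a v : output i (a *: v) = a *: output i v.
Proof.
apply/matrixP => j l; rewrite [RHS]mxE !outputE mulr_sumr.
by apply: eq_bigr => s _; rewrite mxE mulrCA.
Qed.

Lemma outputN i v : output i (- v) = - output i v.
Proof. by rewrite -scaleN1r outputZ scaleN1r. Qed.

Lemma output_continuous i : continuous (output i).
Proof.
move=> v; apply/(cvg_ballP (FF := nbhs_filter v)) => e e0.
have : \forall x \near nbhs v, forall p : 'I_my * 'I_1,
    ball (output i v p.1 p.2) e (output i x p.1 p.2).
  apply: filter_forall => -[j l] /=.
  have : output i x j l @[x --> v] --> output i v j l.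
    rewrite outputE; under eq_fun do rewrite outputE.
    apply: (cvg_sumr (FF := nbhs_filter v)) => s.
    have h := @coord_continuous R _ _ (mxvec_index j s) 0 v.
    exact: (cvgM (cvg_cst _) h).
  by move/(cvg_ballP (FF := nbhs_filter v)); apply.
apply: filterS => x h; split=> // j l; exact: (h (j, l)).
Qed.

(** Cauchy-Schwarz in each output coordinate. This is where the squared row norms in L_H come
    from. *)
Lemma sqnorm2_output_le i v :
  sqnorm2 (output i v) <= norm2 (row i B) ^+ 2 * sqnorm2 v.
Proof.
pose b : 'cV[R]_(mH + 1) := \col_s B i s.
have -> : norm2 (row i B) ^+ 2 = sqnorm2 b.
  rewrite norm2_sqr sqnorm2_cV /sqnorm2 big_ord1; apply: eq_bigr => s _.
  by rewrite !mxE.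
have -> : sqnorm2 v = \sum_(j < my) sqnorm2 (\col_s v (mxvec_index j s) 0).
  rewrite sqnorm2_cV (reindex _ (curry_mxvec_bij _ _))/=.
  under [RHS]eq_bigr do rewrite sqnorm2_cV.
  by rewrite pair_bigA/=; apply: eq_bigr => -[j s] _ /=; rewrite mxE.
rewrite sqnorm2_cV mulr_sumr; apply: ler_sum => j _.
rewrite outputE [X in X ^+ 2](_ : _ = dot b (\col_s v (mxvec_index j s) 0)).
  exact: dot_sqr_le.
by apply: eq_bigr => s _; rewrite !mxE.
Qed.

End LastLayer.

Section Objective.
Variables (R : realType) (n mH my dh : nat).
Variables (hX : 'cV[R]_dh -> 'M[R]_(n, mH)) (ell : 'cV[R]_my -> 'cV[R]_my -> R).
Variables (y : 'I_n -> 'cV[R]_my) (u : 'cV[R]_dh).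
Hypothesis ell_diff : forall i q, differentiable (ell^~ (y i)) q.

Notation B := (augment (hX u)).

Definition last_objective (v : 'cV[R]_(my * (mH + 1))) : R :=
  objective hX ell y (col_mx u v).

Lemma last_objectiveE v :
  last_objective v = n%:R^-1 * \sum_i ell (output B i v) (y i).
Proof.
rewrite /last_objective /objective /network col_mxKu col_mxKd.
by [].
Qed.

Lemma last_objective_continuous : continuous last_objective.
Proof.
move=> v; rewrite (funext last_objectiveE).
apply: (cvgMl_tmp (FF := nbhs_filter v)); apply: (cvg_sumr (FF := nbhs_filter v)) => i.
apply: (@cvg_comp _ _ _ (output B i) (ell^~ (y i))).
  exact: output_continuous.
by have /differentiable_continuous := ell_diff i (output B i v).
Qed.

Lemma last_objective_measurable d (T : measurableType d)
    (V : T -> 'cV[R]_(my * (mH + 1))) : random_vector V ->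
  measurable_fun setT (fun w => last_objective (V w)).
Proof.
move=> mV; under eq_fun do rewrite last_objectiveE.
apply: measurable_funM => //; apply: measurable_sum => i.
apply: (@continuous_coord_measurable _ _ _ _ (ell^~ (y i)) (fun w => output B i (V w))).
  by move=> q; have /differentiable_continuous := ell_diff i q.
move=> j; under eq_fun do rewrite outputE.
by apply: measurable_sum => s; apply: measurable_funM => //; exact: mV.
Qed.

(** Outputs are linear in the last layer, so a difference quotient of the objective along [d'] is an
    average of difference quotients of the losses along [output B i d']. The basis directions
    defining the gradient are then recombined with the weights [d l 0]. *)
Lemma gradient_last_objective v d :
  dot (gradient last_objective v) d =
  n%:R^-1 * \sum_i dot (gradient (ell^~ (y i)) (output B i v)) (output B i d).
Proof.
have D d' : 'D_d' last_objective v =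
    n%:R^-1 * \sum_i dot (gradient (ell^~ (y i)) (output B i v)) (output B i d').
  pose F i v := ell (output B i v) (y i).
  have dF i : is_derive v d' (F i) (dot (gradient (ell^~ (y i)) (output B i v)) (output B i d')).
    have E : (fun h => h^-1 *: ((F i \o shift v) (h *: d') - F i v)) =
        (fun h => h^-1 *: ((ell^~ (y i) \o shift (output B i v)) (h *: output B i d')
                 - ell (output B i v) (y i))).
      by apply/funext => h; rewrite /F /= outputD outputZ.
    rewrite -derive_gradient//; split.
      by rewrite /derivable E; apply: diff_derivable.
    by rewrite /derive E.
  have -> : last_objective = n%:R^-1 *: (\sum_i F i).
    apply/funext => v'; rewrite last_objectiveE /= fct_sumE.
    by [].
  exact: derive_val.
have -> : dot (gradient last_objective v) d =
    \sum_l (n%:R^-1 * \sum_i dot (gradient (ell^~ (y i)) (output B i v))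
      (output B i (delta_mx l 0))) * d l 0.
  by apply: eq_bigr => l _; rewrite mxE D.
under eq_bigr do rewrite -mulrA mulr_suml.
rewrite -mulr_sumr exchange_big/=; congr (_ * _); apply: eq_bigr => i _.
rewrite [in RHS](_ : output B i d = \sum_l d l 0 *: output B i (delta_mx l 0)).
  set g := gradient _ _.
  have : forall (r : seq 'I_(my * (mH + 1))),
    \sum_(l <- r) dot g (output B i (delta_mx l 0)) * d l 0 =
      dot g (\sum_(l <- r) d l 0 *: output B i (delta_mx l 0)).
    elim=> [|l r IH]; first by rewrite !big_nil /dot big1// => s _; rewrite [X in _ * X]mxE mulr0.
    by rewrite !big_cons dotDr dotZr IH mulrC.
  exact.
apply/matrixP => j l; rewrite outputE summxE.
under [RHS]eq_bigr do rewrite mxE outputE mulr_sumr.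
rewrite exchange_big/=; apply: eq_bigr => s _.
rewrite (bigD1 (mxvec_index j s))//= !mxE !eqxx mulr1 big1 ?addr0 1?mulrC// => t ts.
by rewrite mxE eq_sym (negPf ts) /= !mulr0.
Qed.

Lemma last_objective_convex (ell_convex : forall i, convex_function setT (ell^~ (y i))) v v' :
  last_objective v + dot (gradient last_objective v) (v' - v) <= last_objective v'.
Proof.
rewrite gradient_last_objective !last_objectiveE -mulrDr.
rewrite ler_wpM2l ?invr_ge0// -big_split/=; apply: ler_sum => i _.
by rewrite outputD outputN; exact: convex_gradient_le.
Qed.

Lemma last_objective_descent (Lell : R) : 0 <= Lell ->
  (forall i q q', norm2 (gradient (ell^~ (y i)) q - gradient (ell^~ (y i)) q')
      <= Lell * norm2 (q - q')) ->
  forall v v', last_objective v' <= last_objective v +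
    dot (gradient last_objective v) (v' - v) +
    smoothness_const hX Lell u / 2 * sqnorm2 (v' - v).
Proof.
move=> L0 lip v v'; rewrite gradient_last_objective !last_objectiveE.
rewrite /smoothness_const [Lell / _]mulrC -!mulrA -!mulrDr ler_wpM2l ?invr_ge0//.
rewrite mulr_suml mulr_sumr -!big_split/=; apply: ler_sum => i _.
rewrite outputD outputN.
apply: (le_trans (descent (output B i v) (output B i v') (ell_diff i) (lip i))).
rewrite lerD2l -outputN -outputD -mulrA ler_wpM2l// mulrCA ler_wpM2l ?invr_ge0//.
by exact: sqnorm2_output_le.
Qed.

(* A nonzero Gram determinant makes [W |-> B W] surjective, so the last layer
   alone can reproduce the outputs of any network. *)
Lemma last_objective_attains : expressivity_det hX u != 0 ->
  forall w, exists v, last_objective v = objective hX ell y w.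
Proof.
move=> det0 w; set N := network hX w.
pose W : 'M[R]_(mH + 1, my) := B^T *m invmx (B *m B^T) *m N.
exists (mxvec W^T)^T.
rewrite /last_objective /objective /network col_mxKu col_mxKd /last_matrix.
rewrite trmxK mxvecK trmxK -/N /W !mulmxA mulmxV ?mul1mx//.
by rewrite unitmxE unitfE.
Qed.

End Objective.

(** * Square integrability and the distance to the minimizers *)

Section Integrable.
Context d (T : measurableType d) (R : realType) (P : probability T R).
Implicit Types f g : T -> R.

Notation L1 f := (P.-integrable setT (EFin \o f)).
Notation E f := (Rintegral P setT f).

Lemma L1_measurable f : L1 f -> measurable_fun setT f.
Proof. by move=> /measurable_int/measurable_EFinP. Qed.

Lemma L1_cst a : L1 (cst a).
Proof. exact: finite_measure_integrable_cst. Qed.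

Lemma L1_le f g : measurable_fun setT f -> (forall w, `|f w| <= `|g w|) ->
  L1 g -> L1 f.
Proof.
move=> mf fg; apply: le_integrable => //; first exact/measurable_EFinP.
by move=> w _; rewrite /= lee_fin.
Qed.

Lemma L1_add f g : L1 f -> L1 g -> L1 (fun w => f w + g w).
Proof.
move=> Lf Lg; rewrite (_ : EFin \o _ = (EFin \o f) \+ (EFin \o g))%E//.
exact: integrableD.
Qed.

Lemma L1_scale a f : L1 f -> L1 (fun w => a * f w).
Proof.
move=> Lf; rewrite (_ : EFin \o _ = (fun w => a%:E * (EFin \o f) w)%E)//.
exact: integrableZl.
Qed.

Lemma L1_sub f g : L1 f -> L1 g -> L1 (fun w => f w - g w).
Proof.
move=> Lf Lg; rewrite (_ : (fun _ => _) = (fun w => f w + -1 * g w)).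
  by apply: L1_add => //; exact: L1_scale.
by apply/funext => w; rewrite mulN1r.
Qed.

Lemma L1_sum (I : Type) (r : seq I) (f : I -> T -> R) :
  (forall i, L1 (f i)) -> L1 (fun w => \sum_(i <- r) f i w).
Proof.
move=> Lf; elim: r => [|i r IH].
  by under eq_fun do rewrite big_nil; exact: L1_cst.
by under eq_fun do rewrite big_cons; exact: L1_add.
Qed.

Lemma Rintegral_sum (I : Type) (r : seq I) (f : I -> T -> R) :
  (forall i, L1 (f i)) ->
  E (fun w => \sum_(i <- r) f i w) = \sum_(i <- r) E (f i).
Proof.
move=> Lf; elim: r => [|i r IH].
  under eq_fun do rewrite big_nil.
  by rewrite big_nil Rintegral_cst// mul0r.
under eq_fun do rewrite big_cons.
by rewrite big_cons RintegralD// ?IH//; exact: L1_sum.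
Qed.

Lemma expectation_Rintegral f : L1 f -> ('E_P[f] = (E f)%:E)%E.
Proof. by move=> Lf; rewrite expectation.unlock fineK// integrable_fin_num. Qed.

Lemma expectation_lty f : measurable_fun setT f -> (forall w, 0 <= f w) ->
  ('E_P[f] < +oo)%E -> L1 f.
Proof.
move=> mf f0; rewrite expectation.unlock => foo; apply/integrableP; split.
  exact/measurable_EFinP.
by under eq_integral do rewrite /= ger0_norm//.
Qed.

Lemma L1_mul_sq f g : measurable_fun setT f -> measurable_fun setT g ->
  L1 (fun w => f w ^+ 2) -> L1 (fun w => g w ^+ 2) -> L1 (fun w => f w * g w).
Proof.
move=> mf mg Lf Lg; apply: (L1_le _ _ (L1_add Lf Lg)); first exact: measurable_funM.
move=> w; rewrite (ger0_norm (addr_ge0 (sqr_ge0 _) (sqr_ge0 _))) normrM.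
rewrite -(real_normK (num_real (f w))) -(real_normK (num_real (g w))).
have := sqr_ge0 (`|f w| - `|g w|).
have := mulr_ge0 (normr_ge0 (f w)) (normr_ge0 (g w)).
rewrite !expr2; nra.
Qed.

Lemma L1_of_sq f : measurable_fun setT f -> L1 (fun w => f w ^+ 2) -> L1 f.
Proof.
move=> mf Lf; have := L1_mul_sq mf (measurable_cst (1 : R)) Lf.
have -> : (fun w => f w * 1) = f by apply/funext => w; rewrite mulr1.
by apply; under eq_fun do rewrite expr1n; exact: L1_cst.
Qed.

Lemma L1_coord_sq (k : nat) (X : T -> 'cV[R]_k) i : random_vector X ->
  L1 (fun w => sqnorm2 (X w)) -> L1 (fun w => X w i 0 ^+ 2).
Proof.
move=> mX; apply: L1_le; first exact: measurable_funX.
move=> w; rewrite !ger0_norm ?sqnorm2_ge0 ?sqr_ge0// sqnorm2_cV (bigD1 i)//=.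
by rewrite lerDl sumr_ge0// => j _; exact: sqr_ge0.
Qed.

Lemma measurable_sqnorm2 (k : nat) (X : T -> 'cV[R]_k) : random_vector X ->
  measurable_fun setT (fun w => sqnorm2 (X w)).
Proof.
move=> mX; under eq_fun do rewrite sqnorm2_cV.
by apply: measurable_sum => i; exact: measurable_funX.
Qed.

Lemma random_vectorB (k : nat) (X Y : T -> 'cV[R]_k) :
  random_vector X -> random_vector Y -> random_vector (fun w => X w - Y w).
Proof.
move=> mX mY i; rewrite (_ : (fun _ => _) = (fun w => X w i 0 - Y w i 0)).
  exact: measurable_funB.
by apply/funext => w; rewrite !mxE.
Qed.

Lemma random_vectorZ (k : nat) a (X : T -> 'cV[R]_k) :
  random_vector X -> random_vector (fun w => a *: X w).
Proof.
move=> mX i; under eq_fun do rewrite mxE.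
by apply: measurable_funM => //; exact: mX.
Qed.

Lemma random_vector_cst (k : nat) (v : 'cV[R]_k) :
  random_vector (fun _ : T => v).
Proof. by move=> i; exact: measurable_cst. Qed.

(** Expanding around one point [v0] at finite expected squared distance makes the dependence on [v]
    an explicit quadratic, so that minimizing over [v] becomes a deterministic problem. *)
Lemma expectation_sqdist_shift (k : nat) (X : T -> 'cV[R]_k) (v0 v : 'cV[R]_k) :
  random_vector X -> L1 (fun w => sqnorm2 (v0 - X w)) ->
  'E_P[fun w => (norm2 (v - X w) ^+ 2)%R]%E =
   (E (fun w => sqnorm2 (v0 - X w)) + sqnorm2 (v - v0) +
     2 * dot (v - v0) (\col_i E (fun w => (v0 - X w) i 0)))%:E.
Proof.
move=> mX L0; set d0 := v - v0.
have mX0 : random_vector (fun w => v0 - X w).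
  by apply: random_vectorB => //; exact: random_vector_cst.
have Li i : L1 (fun w => (v0 - X w) i 0).
  by apply: L1_of_sq (mX0 i) _; exact: (L1_coord_sq i mX0).
have Ldot : L1 (fun w => dot d0 (v0 - X w)).
  by apply: L1_sum => i; exact: L1_scale.
have -> : (fun w => norm2 (v - X w) ^+ 2) =
    (fun w => sqnorm2 d0 + (2 * dot d0 (v0 - X w) + sqnorm2 (v0 - X w))).
  apply/funext => w; rewrite norm2_sqr -[v](subrK v0) -/d0 -addrA (sqnorm2D d0).
  by rewrite addrA.
rewrite expectation_Rintegral; last first.
  apply: L1_add; first exact: L1_cst.
  by apply: L1_add => //; exact: L1_scale.
congr (_%:E); rewrite RintegralD//; [|exact: L1_cst|]; last first.
  by apply: L1_add => //; exact: L1_scale.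
rewrite RintegralD//; last exact: L1_scale.
rewrite Rintegral_cst// (_ : fine _ = 1) ?mulr1 ?RintegralZl//; last first.
  exact: (congr1 fine (probability_setT P)).
rewrite [in LHS]/dot Rintegral_sum; last by move=> i; exact: L1_scale.
under eq_bigr do rewrite RintegralZl//.
rewrite (_ : \sum_i _ = dot d0 (\col_i E (fun w => (v0 - X w) i 0))).
  by ring.
by apply: eq_bigr => i _; congr (_ * _); rewrite [RHS]mxE.
Qed.

End Integrable.

Lemma trmx_continuous (R : realType) (k : nat) :
  continuous (fun x : 'rV[R]_k => x^T).
Proof.
move=> x; apply/(cvg_ballP (FF := nbhs_filter x)) => e e0.
apply/nbhs_ballP; exists e => // z [_ xz]; split=> // i j.
by rewrite !mxE; exact: xz.
Qed.

Lemma sqnorm2_continuous (R : realType) (k : nat) (a : 'cV[R]_k) :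
  continuous (fun x : 'cV[R]_k => sqnorm2 (x - a)).
Proof.
have -> : (fun x : 'cV[R]_k => sqnorm2 (x - a)) =
    (fun x => \sum_i (x - a) i 0 ^+ 2) by apply/funext => x; rewrite sqnorm2_cV.
move=> x.
apply: (cvg_sumr (FF := nbhs_filter x)) => i.
have h : (z - a) i 0 @[z --> x] --> (x - a) i 0.
  rewrite !mxE; under eq_fun do rewrite !mxE.
  exact: (cvgB (@coord_continuous R _ _ i 0 x) (cvg_cst _)).
exact: (cvgM h h).
Qed.

Lemma dot_continuous (R : realType) (k : nat) (m a : 'cV[R]_k) :
  continuous (fun x : 'cV[R]_k => dot (x - a) m).
Proof.
move=> x; apply: (cvg_sumr (FF := nbhs_filter x)) => i.
rewrite !mxE; under eq_fun do rewrite !mxE.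
exact: (cvgM (cvgB (@coord_continuous R _ _ i 0 x) (cvg_cst _)) (cvg_cst _)).
Qed.

Lemma quadratic_min (R : realType) (k : nat) (Q : set 'cV[R]_k) (v0 m : 'cV[R]_k) :
  closed Q -> Q v0 -> exists2 v, Q v & forall v', Q v' ->
    sqnorm2 (v - v0) + 2 * dot (v - v0) m <= sqnorm2 (v' - v0) + 2 * dot (v' - v0) m.
Proof.
move=> cQ Qv0.
pose r (v : 'cV[R]_k) := sqnorm2 (v - v0) + 2 * dot (v - v0) m.
have cr : continuous r.
  move=> v; exact: (cvgD (@sqnorm2_continuous R k v0 v)
    (cvgM (cvg_cst _) (@dot_continuous R k m v0 v))).
(* By Cauchy-Schwarz the quadratic is nonnegative, hence at least its value 0 at [v0], as soon as
   the distance to [v0] is at least [2 * norm2 m]; a minimum over this compact part is global. Row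
   vectors serve [bounded_closed_compact]. *)
pose A := [set x : 'rV[R]_k | Q x^T /\ sqnorm2 (x^T - v0) <= 4 * sqnorm2 m].
have cA : compact A.
  apply: bounded_closed_compact.
    pose b := Num.sqrt (4 * sqnorm2 m) + norm2 v0.
    exists b; split; first exact: num_real.
    move=> M bM x [_ xm].
    have M0 : 0 <= M.
      by rewrite ltW// (le_lt_trans _ bM)// addr_ge0 ?sqrtr_ge0// norm2_ge0.
    have entry (z : 'cV[R]_k) i : `|z i 0| <= norm2 z.
      rewrite -sqrtr_sqr ler_wsqrtr// sqnorm2_cV (bigD1 i)//= lerDl.
      by apply: sumr_ge0 => j _; exact: sqr_ge0.
    suff : mx_norm x <= M by [].
    rewrite mx_normrE; apply: bigmax_le => // -[i j] _ /=.
    rewrite (ord1 i) -[x]trmxK mxE -[x^T](subrK v0) mxE.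
    apply: (le_trans (ler_normD _ _)); apply: ltW; apply: le_lt_trans bM.
    apply: lerD; last exact: entry.
    by rewrite (le_trans (entry _ _))// ler_wsqrtr.
  rewrite (_ : A = (fun x : 'rV[R]_k => x^T) @^-1`
     (Q `&` (fun v : 'cV[R]_k => sqnorm2 (v - v0)) @^-1` [set t | t <= 4 * sqnorm2 m]))//.
  apply: closed_comp; first by move=> x _; exact: trmx_continuous.
  apply: closedI => //; apply: closed_comp; last exact: closed_le.
  by move=> x _; exact: sqnorm2_continuous.
have [] := @compact_EVT_min _ _ (fun x : 'rV[R]_k => r x^T) A _ cA.
- exists v0^T; split; rewrite trmxK// subrr sqnorm20.
  by rewrite mulr_ge0 ?sqnorm2_ge0.
- apply: continuous_subspaceT => x.
  exact: (@cvg_comp _ _ _ _ r _ _ _ (@trmx_continuous R k x) (cr x^T)).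
move=> x /set_mem[Qx xm] xmin; exists x^T => // v' Qv'.
have r0 : r v0 = 0.
  by rewrite /r subrr sqnorm20 dot0l mulr0 addr0.
have [le4|gt4] := leP (sqnorm2 (v' - v0)) (4 * sqnorm2 m).
  have := xmin v'^T; rewrite trmxK; apply; apply/mem_set; split; by rewrite trmxK.
apply: (@le_trans _ _ (r v0)).
  have := xmin v0^T; rewrite trmxK; apply; apply/mem_set; split; rewrite trmxK//.
  by rewrite subrr sqnorm20 mulr_ge0 ?sqnorm2_ge0.
rewrite r0; set s := v' - v0 in gt4 *.
have : - dot s m <= norm2 s * norm2 m.
  rewrite -dotNl (le_trans (dot_le_norm2 _ _))//.
  by rewrite [norm2 (- s)]/norm2 sqnorm2N.
have : 2 * norm2 m <= norm2 s.
  rewrite -(@ler_sqr R) ?nnegrE ?mulr_ge0 ?norm2_ge0//.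
  by rewrite exprMn !norm2_sqr -natrX ltW.
rewrite -norm2_sqr; have := norm2_ge0 s; have := norm2_ge0 m.
by rewrite expr2; nra.
Qed.

(** Either some point of [Q] has finite expected squared distance and [quadratic_min] applies, or
    all values are [+oo] and any point attains the minimum. *)
Lemma expected_sqdist_min (R : realType) d (T : measurableType d)
    (P : probability T R) (k : nat) (X : T -> 'cV[R]_k) (Q : set 'cV[R]_k) :
  random_vector X -> closed Q -> Q !=set0 -> exists R2 : \bar R,
    is_minimum [set 'E_P[fun w => (norm2 (v - X w) ^+ 2)%R]%E | v in Q] R2.
Proof.
move=> mX cQ [q Qq]; pose J (v : 'cV[R]_k) := 'E_P[fun w => (norm2 (v - X w) ^+ 2)%R]%E.
have [[v0 [Qv0 J0]]|noJ] := pselect (exists v0, Q v0 /\ (J v0 < +oo)%E).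
  have L0 : P.-integrable setT (EFin \o (fun w => sqnorm2 (v0 - X w))).
    apply: expectation_lty; last 2 first.
    - by move=> w; exact: sqnorm2_ge0.
    - by move: J0; rewrite /J; under eq_fun do rewrite norm2_sqr.
    by apply: measurable_sqnorm2; apply: random_vectorB.
  pose m : 'cV[R]_k := \col_i Rintegral P setT (fun w => (v0 - X w) i 0).
  have [v Qv vmin] := quadratic_min m cQ Qv0.
  exists (J v); split; first by exists v.
  move=> _ [v' Qv' <-]; rewrite /J !(expectation_sqdist_shift _ mX L0) lee_fin.
  by rewrite -!addrA lerD2l vmin.
have Jy v : Q v -> J v = +oo%E.
  move=> Qv; apply/eqP; rewrite -leye_eq leNgt; apply/negP => Jv.
  by apply: noJ; exists v.
exists +oo%E; split; first by exists q => //; exact: Jy.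
by move=> _ [v Qv <-]; rewrite -/(J v) Jy.
Qed.

(** * Gradient descent with a fixed step *)

Lemma gradient_descent_rate (R : realType) (k : nat) (F : 'cV[R]_k -> R)
    (L : R) (vs : 'cV[R]_k) (v : nat -> 'cV[R]_k) :
  0 < L ->
  (forall a b, F a + dot (gradient F a) (b - a) <= F b) ->
  (forall a b, F b <= F a + dot (gradient F a) (b - a) + L / 2 * sqnorm2 (b - a)) ->
  (forall s, v s.+1 = v s - L^-1 *: gradient F (v s)) ->
  forall s, s%:R * (F (v s) - F vs) <= L / 2 * sqnorm2 (vs - v 0%N).
Proof.
move=> L0 cF dF vS s.
(* Keeping the current distance on the right makes the induction telescope: one step decreases [F],
   and [F (v s.+1) - F vs] is at most [L / 2] times the drop in squared distance. *)
suff : s%:R * (F (v s) - F vs) <=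
    L / 2 * (sqnorm2 (vs - v 0%N) - sqnorm2 (vs - v s)).
  have L2 : 0 <= L / 2 by rewrite divr_ge0// ltW.
  move/le_trans; apply; rewrite ler_wpM2l//.
  by rewrite gerDl oppr_le0 sqnorm2_ge0.
elim: s => [|s IH]; first by rewrite subrr mulr0 mul0r.
have c1 := cF (v s) vs; have d1 := dF (v s) (v s.+1).
set g := gradient F (v s) in c1 d1.
have E : v s.+1 - v s = - (L^-1 *: g) by rewrite vS addrAC subrr add0r.
rewrite E sqnorm2N sqnorm2Z dotNr dotZr dotxx in d1.
have E2 : vs - v s.+1 = (vs - v s) + L^-1 *: g by rewrite vS opprB addrA addrAC.
rewrite E2 (sqnorm2D (vs - v s)) dotZr sqnorm2Z dotC.
set a := dot g (vs - v s) in c1 *; set q := sqnorm2 g in d1 *.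
set D0 := sqnorm2 (vs - v 0%N) in IH *; set Ds := sqnorm2 (vs - v s) in IH *.
have q0 : 0 <= q by exact: sqnorm2_ge0.
have hL : L / 2 * (L^-1 ^+ 2 * q) = L^-1 / 2 * q.
  by field; rewrite gt_eqF.
have hL2 : L / 2 * (2 * (L^-1 * a)) = a by field; rewrite gt_eqF.
rewrite hL in d1.
have Lq : 0 <= L^-1 * q by rewrite mulr_ge0// invr_ge0 ltW.
have sR : 0 <= s%:R :> R by [].
have dec : F (v s.+1) <= F (v s) by lra.
have -> : L / 2 * (D0 - (Ds + 2 * (L^-1 * a) + L^-1 ^+ 2 * q)) =
  L / 2 * (D0 - Ds) - a - L^-1 / 2 * q by rewrite -hL -[in RHS]hL2; ring.
rewrite -natr1 mulrDl mul1r.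
have : s%:R * (F (v s.+1) - F vs) <= s%:R * (F (v s) - F vs).
  by rewrite ler_wpM2l// lerD2r.
lra.
Qed.

(** With [M <= 0] the function lies below its tangent planes. A nonzero gradient would then push it
    below 0, so all gradients vanish and any two values bound each other. *)
Lemma nonpos_lipschitz_cst (R : realType) (k : nat) (f : 'cV[R]_k -> R) (M : R) :
  M <= 0 -> (forall q, 0 <= f q) -> (forall z, differentiable f z) ->
  (forall z z', norm2 (gradient f z - gradient f z') <= M * norm2 (z - z')) ->
  forall x y, f x = f y.
Proof.
move=> M0 f0 df lip.
have h x y : f y <= f x + dot (gradient f x) (y - x).
  have := descent x y df lip => /le_trans; apply.
  by rewrite gerDl mulr_le0_ge0 ?sqnorm2_ge0// pmulr_lle0.
have g0 x : gradient f x = 0.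
  apply: sqnorm2_eq0; apply/eqP; rewrite eq_le sqnorm2_ge0 andbT leNgt.
  apply/negP => q0; set q := sqnorm2 _ in q0.
  (* This step length brings the tangent plane at [x] down to the value -1. *)
  have := h x (x - ((f x + 1) / q) *: gradient f x).
  rewrite addrAC subrr add0r dotNr dotZr dotxx -/q divfK ?gt_eqF// => h1.
  have := f0 (x - ((f x + 1) / q) *: gradient f x); lra.
move=> x y; apply/eqP; rewrite eq_le.
have := h x y; have := h y x; by rewrite !g0 !dot0l !addr0 => -> ->.
Qed.

(** * Conditional expectations *)

Lemma indic_bool (R : realType) (T : Type) (p : T -> bool) (w : T) :
  \1_[set x | p x] w = (p w)%:R :> R.
Proof. by rewrite indicE; congr (_%:R : R); congr nat_of_bool; apply/idP/idP; rewrite inE. Qed.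

Section ConditionalExpectation.
Context d (T : measurableType d) (R : realType) (P : probability T R).
Variables (k : nat) (Z : T -> 'cV[R]_k).
Hypothesis mZ : random_vector Z.

Notation L1 f := (P.-integrable setT (EFin \o f)).
Notation E f := (Rintegral P setT f).

(** [T] carrying the sigma-algebra [sigma_generated Z], so that [measurable_fun] from this type
    expresses measurability with respect to [Z]. *)
Definition generated_type := g_sigma_algebraType
  (\big[setU/set0]_(i < k) preimage_set_system setT (fun w => Z w i 0) measurable).

Lemma generated_measurable (A : set T) : sigma_generated Z A -> measurable A.
Proof.
apply: smallest_sub; first exact: sigma_algebra_measurable.
apply: (big_ind (fun G : set (set T) => G `<=` measurable)) => //.
- by move=> G1 G2 h1 h2 A' [/h1|/h2].
- by move=> i _ _ [B mB <-]; exact: mZ.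
Qed.

Lemma generated_coord (i : 'I_k) :
  measurable_fun setT (fun w : generated_type => Z w i 0).
Proof.
move=> _ B mB; rewrite setTI; apply: sub_sigma_algebra.
by rewrite (bigD1 i)//=; left; exists B => //; rewrite setTI.
Qed.

Lemma generated_measurable_fun (S : T -> R) :
  measurable_fun [set: generated_type] (S : generated_type -> R) ->
  measurable_fun setT S.
Proof.
move=> mS _ B mB; rewrite setTI; apply: generated_measurable.
by have := mS measurableT B mB; rewrite setTI.
Qed.

Lemma Rintegral_indic_mul (U : T -> R) (A : set T) : measurable A ->
  E (fun w => U w * \1_A w) = Rintegral P A U.
Proof.
move=> mA; rewrite [RHS]Rintegral_mkcond; apply: eq_Rintegral => w _.
by rewrite patchE indicE; case: (w \in A); rewrite ?mulr1 ?mulr0.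
Qed.

Lemma L1_bounded_mul (U S : T -> R) (M : R) : L1 U -> measurable_fun setT S ->
  (forall w, `|S w| <= M) -> L1 (fun w => U w * S w).
Proof.
move=> LU mS SM; apply: (L1_le _ _ (L1_scale M LU)).
  by apply: measurable_funM => //; exact: L1_measurable LU.
by move=> w; rewrite !normrM mulrC ler_wpM2r// (le_trans (SM w))// ler_norm.
Qed.

(** The sum counts the positive integers up to [a], that is, it is the integer part of [a] written
    with indicators of level sets. *)
Lemma count_approx (a : R) (K : nat) : 0 <= a <= K%:R ->
  `|a - \sum_(m < K) (m.+1%:R <= a)%R%:R| <= 1.
Proof.
move=> /andP[a0]; elim: K => [aK|K IH aK].
  by rewrite big_ord0 subr0 ger0_norm// (le_trans aK).
rewrite big_ord_recr/=; have [aK'|Ka] := leP a K%:R.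
  have -> : (K.+1%:R <= a)%R = false.
    by apply/negbTE; rewrite -ltNge (le_lt_trans aK')// ltr_nat.
  by rewrite addr0 IH.
rewrite (eq_bigr (fun=> 1)) => [|i _]; last first.
  by rewrite (le_trans _ (ltW Ka))// ler_nat.
rewrite sumr_const card_ord; have aK1 : a <= K%:R + 1 by rewrite natr1.
by case: (leP K.+1%:R a) => h; rewrite /= ?mulr1n ?mulr0n ler_norml;
  move: h; rewrite -natr1 => h; lra.
Qed.

(** The definition tests [U = X - V] against indicators only. Approximating [S] yields [|E[U S]| *
    (q + 1) <= E|U|] for every [q], which forces the integral to vanish. *)
Lemma cond_expectation_bounded (X V S : T -> R) (M : R) :
  is_cond_expectation P X Z V ->
  measurable_fun [set: generated_type] (S : generated_type -> R) ->
  (forall w, `|S w| <= M) ->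
  E (fun w => X w * S w) = E (fun w => V w * S w).
Proof.
move=> [LX LV mV XV] mS SM.
have mST := generated_measurable_fun mS.
pose U w := X w - V w.
have LU : L1 U by exact: L1_sub.
suff US0 : E (fun w => U w * S w) = 0.
  apply/eqP; rewrite -subr_eq0 -RintegralB//; last 2 first.
  - exact: L1_bounded_mul LX mST SM.
  - exact: L1_bounded_mul LV mST SM.
  rewrite -US0; apply/eqP; apply: eq_Rintegral => w _; by rewrite -mulrBl.
have indic0 A : sigma_generated Z A -> E (fun w => U w * \1_A w) = 0.
  move=> sA; have mA := generated_measurable sA.
  have LXA := integrableS measurableT mA (@subsetT _ _) LX.
  have LVA := integrableS measurableT mA (@subsetT _ _) LV.
  rewrite Rintegral_indic_mul// RintegralB// /Rintegral.
  by have /= -> := XV A sA; rewrite subrr.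
(* Up to [1 / (q + 1)], [S] is an affine combination of indicators of sets
   generated by [Z], against which [X] and [V] have the same integral. *)
have approx (q : nat) : `|E (fun w => U w * S w)| * q.+1%:R <= E (fun w => `|U w|).
  pose a w := q.+1%:R * (S w + M).
  have [K aK] : exists K : nat, forall w, a w <= K%:R.
    exists (Num.bound `|q.+1%:R * (M + M)|) => w.
    rewrite ltW// (le_lt_trans _ (archi_boundP (normr_ge0 _)))//.
    rewrite (le_trans _ (ler_norm _))// ler_wpM2l// lerD2r.
    by rewrite (le_trans (ler_norm _) (SM w)).
  have a0 w : 0 <= a w.
    rewrite mulr_ge0// -lerBlDr sub0r.
    by have := SM w; rewrite ler_norml => /andP[].
  pose A m := [set w | m.+1%:R <= a w].
  have sA m : sigma_generated Z (A m).
    have ma : measurable_fun [set: generated_type] (a : generated_type -> R).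
      by apply: measurable_funM => //; exact: measurable_funD.
    have := ma measurableT `[m.+1%:R, +oo[%classic (measurable_itv _).
    rewrite setTI; congr (sigma_generated Z _).
    by apply/seteqP; split => w; rewrite /= in_itv/= andbT.
  have mA m := generated_measurable (sA m).
  pose C w : R := \sum_(m < K) (m.+1%:R <= a w)%R%:R.
  have CE w : C w = \sum_(m < K) \1_(A m) w.
    by apply: eq_bigr => m _; exact/esym/indic_bool.
  have mC : measurable_fun setT C.
    rewrite (funext CE); apply: measurable_sum => m; exact: measurable_indic.
  have C1 w : `|a w - C w| <= 1 by apply: count_approx; rewrite a0 aK.
  have Cb w : `|C w| <= K%:R.
    rewrite (le_trans (ler_norm_sum _ _ _))//.
    apply: (@le_trans _ _ (\sum_(m < K) 1)); last by rewrite sumr_const card_ord.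
    by apply: ler_sum => m _; rewrite normr_nat lern1 leq_b1.
  have UC0 : E (fun w => U w * C w) = 0.
    under eq_Rintegral do rewrite CE mulr_sumr.
    rewrite Rintegral_sum; first by rewrite big1// => m _; exact: indic0.
    move=> m; apply: (@L1_bounded_mul _ _ 1) => // w.
    by rewrite indicE normr_nat lern1 leq_b1.
  have U0 : E U = 0.
    have sT : sigma_generated Z setT by exact: (@measurableT _ generated_type).
    by rewrite -(indic0 _ sT); apply: eq_Rintegral => w _; rewrite indicT mulr1.
  have ma : measurable_fun setT a.
    by apply: measurable_funM => //; exact: measurable_funD.
  have LUS := L1_bounded_mul LU mST SM.
  have LUC := L1_bounded_mul LU mC Cb.
  have LUaC : L1 (fun w => U w * (a w - C w)).
    by apply: L1_bounded_mul C1 => //; exact: measurable_funB.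
  have -> : `|E (fun w => U w * S w)| * q.+1%:R = `|E (fun w => U w * (a w - C w))|.
    rewrite -[X in _ * X](@ger0_norm R)// -normrM; congr `|_|.
    transitivity (E (fun w => q.+1%:R * (U w * S w) + (q.+1%:R * M * U w - U w * C w))).
      rewrite RintegralD//; last 2 first.
        exact: L1_scale.
        by apply: L1_sub => //; exact: L1_scale.
      rewrite RintegralB//; last exact: L1_scale.
      by rewrite !RintegralZl// U0 UC0 mulr0 subr0 addr0 mulrC.
    by apply: eq_Rintegral => w _; rewrite /a; ring.
  rewrite (le_trans (le_normr_Rintegral _ LUaC))//.
  apply: le_Rintegral => //.
  - apply: (L1_le _ _ LUaC) => [|w]; last by rewrite normr_id.
    by apply: measurableT_comp => //; exact: L1_measurable LUaC.
  - apply: (L1_le _ _ LU) => [|w]; last by rewrite normr_id.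
    by apply: measurableT_comp => //; exact: L1_measurable LU.
  - by move=> w _; rewrite normrM ler_piMr.
apply/eqP; rewrite -normr_le0 leNgt; apply/negP => pos.
set e := `|_| in pos approx; set b := E _ in approx.
have := approx (Num.bound `|b / e|).
apply/negP; rewrite -ltNge mulrC -ltr_pdivrMr//.
rewrite (le_lt_trans (ler_norm _))// (lt_trans (archi_boundP (normr_ge0 _)))//.
by rewrite ltr_nat.
Qed.

End ConditionalExpectation.

(** A one-sided tower property: [G] is the stochastic gradient, [Y] the exact one, [D] the
    displacement from a minimizer and [phi] the optimality gap. Integrability of [phi] is part of
    the conclusion. *)
Lemma cond_expectation_dot_le d (T : measurableType d) (R : realType)
    (P : probability T R) (k m : nat) (Z : T -> 'cV[R]_k)
    (G D Y : T -> 'cV[R]_m) (phi : T -> R) :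
  random_vector Z -> random_vector G ->
  (forall j, measurable_fun [set: generated_type Z]
     (fun w : generated_type Z => D w j 0)) ->
  P.-integrable setT (EFin \o (fun w => sqnorm2 (G w))) ->
  P.-integrable setT (EFin \o (fun w => sqnorm2 (D w))) ->
  cond_expectation_eq P G Z Y ->
  measurable_fun setT phi -> (forall w, 0 <= phi w <= dot (Y w) (D w)) ->
  P.-integrable setT (EFin \o phi) /\
  Rintegral P setT phi <= Rintegral P setT (fun w => dot (G w) (D w)).
Proof.
move=> mZ mG sD LG LD cY mphi phiYD.
have mD : random_vector D by move=> j; exact: generated_measurable_fun (sD j).
have LGD : P.-integrable setT (EFin \o (fun w => dot (G w) (D w))).
  apply: L1_sum => j; apply: L1_mul_sq; [exact: mG|exact: mD| |];
  exact: L1_coord_sq.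
have phi0 w : 0 <= phi w by have /andP[] := phiYD w.
(* On the event [sqnorm2 D <= N] the coordinates of [D] are bounded; positivity
   of [phi] allows [N] to tend to infinity without integrability of [Y]. *)
pose I (N : nat) w : R := (sqnorm2 (D w) <= N%:R)%R%:R.
have IE N : I N = \1_[set w | sqnorm2 (D w) <= N%:R].
  by apply/funext => w; rewrite /I indicE mem_setE.
have sq_meas : measurable_fun [set: generated_type Z]
    (fun w : generated_type Z => sqnorm2 (D w)).
  exact: measurable_sqnorm2 sD.
have sI N : measurable_fun [set: generated_type Z] (I N : generated_type Z -> R).
  rewrite IE; apply: measurable_indic.
  have := sq_meas measurableT `]-oo, N%:R]%classic (measurable_itv _).
  by rewrite setTI; congr (measurable _); apply/seteqP; split=> w; rewrite /= in_itv.
have mI N : measurable_fun setT (I N) by exact: generated_measurable_fun (sI N).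
have I01 N w : 0 <= I N w <= 1 by rewrite /I ler0n lern1 leq_b1.
(* Stated with extended integrals, because [phi] is not yet known to be integrable. *)
have trunc N : (\int[P]_w (I N w * phi w)%:E <=
    \int[P]_w (I N w * dot (G w) (D w))%:E)%E.
  have DN j w : `|I N w * D w j 0| <= N%:R + 1.
    rewrite /I; case: (leP (sqnorm2 (D w))) => h; last by rewrite mul0r normr0.
    rewrite mul1r.
    have : D w j 0 ^+ 2 <= N%:R.
      apply: le_trans h; rewrite sqnorm2_cV (bigD1 j)//= lerDl.
      by apply: sumr_ge0 => i _; exact: sqr_ge0.
    rewrite -(real_normK (num_real (D w j 0))).
    have := normr_ge0 (D w j 0); nra.
  have sDN j : measurable_fun [set: generated_type Z]
      (fun w : generated_type Z => I N w * D w j 0).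
    by apply: measurable_funM => //; exact: sI.
  have /= /choice[V] : forall j, exists V : T -> R,
      is_cond_expectation P (fun w => G w j 0) Z V /\
      {ae P, forall w, V w = Y w j 0}.
    by move=> j; have [V V1 V2] := cY j; exists V.
  move=> /all_and2[V1 V2].
  pose W w := \sum_j V j w * (I N w * D w j 0).
  have LV j : P.-integrable setT (EFin \o V j) by have [] := V1 j.
  have LGj j : P.-integrable setT (EFin \o (fun w => G w j 0)) by have [] := V1 j.
  have LVD j : P.-integrable setT (EFin \o (fun w => V j w * (I N w * D w j 0))).
    by apply: L1_bounded_mul (DN j) => //; exact: generated_measurable_fun (sDN j).
  have LGDj j : P.-integrable setT (EFin \o (fun w => G w j 0 * (I N w * D w j 0))).
    by apply: L1_bounded_mul (DN j) => //; exact: generated_measurable_fun (sDN j).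
  have LW : P.-integrable setT (EFin \o W) by exact: L1_sum.
  have -> : (\int[P]_w (I N w * dot (G w) (D w))%:E = \int[P]_w (W w)%:E)%E.
    have LGN : P.-integrable setT (EFin \o (fun w => I N w * dot (G w) (D w))).
      rewrite (_ : (fun _ => _) = (fun w => \sum_j G w j 0 * (I N w * D w j 0))).
        exact: L1_sum.
      apply/funext => w; rewrite /dot mulr_sumr; apply: eq_bigr => j _; ring.
    rewrite -[LHS]fineK ?integrable_fin_num// -[RHS]fineK ?integrable_fin_num//.
    congr (_%:E); transitivity (Rintegral P setT (fun w => \sum_j G w j 0 * (I N w * D w j 0))).
      apply: eq_Rintegral => w _; rewrite /dot mulr_sumr; apply: eq_bigr => j _; ring.
    rewrite Rintegral_sum// [RHS]Rintegral_sum//; apply: eq_bigr => j _.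
    exact: (cond_expectation_bounded mZ (V1 j) (sDN j) (DN j)).
  have mW := L1_measurable LW.
  have aeV : {ae P, forall w, forall j, V j w = Y w j 0} by exact: filter_forall V2.
  have aeW : {ae P, forall w, I N w * phi w <= W w}.
    apply: filterS aeV => w VY; rewrite /W.
    rewrite (_ : \sum_j _ = I N w * dot (Y w) (D w)); last first.
      rewrite /dot mulr_sumr; apply: eq_bigr => j _; rewrite VY; ring.
    have /andP[I0 _] := I01 N w; have /andP[_ pYD] := phiYD w.
    by rewrite ler_wpM2l.
  (* [W] is nonnegative only almost surely; its positive part has the same integral and is
     nonnegative everywhere, as the comparison of integrals requires. *)
  pose Wp w := Num.max (W w) 0.
  have mWp : measurable_fun setT Wp by exact: measurable_maxr.
  have -> : (\int[P]_w (W w)%:E = \int[P]_w (Wp w)%:E)%E.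
    apply: ae_eq_integral; rewrite ?measurable_EFinP//.
    apply: filterS aeW => w h _; congr (_%:E); rewrite /Wp max_l//.
    by rewrite (le_trans _ h)// mulr_ge0//; have /andP[] := I01 N w.
  apply: ae_ge0_le_integral => //.
  - by move=> w _; rewrite lee_fin mulr_ge0//; have /andP[] := I01 N w.
  - by apply/measurable_EFinP; exact: measurable_funM.
  - by move=> w _; rewrite lee_fin /Wp le_max lexx orbT.
  - exact/measurable_EFinP.
  - by apply: filterS aeW => w h _; rewrite lee_fin /Wp le_max h.
have Inear w : \forall N \near \oo, I N w = 1.
  exists (Num.bound (sqnorm2 (D w))) => // N /= hN; rewrite /I.
  rewrite (le_trans (ltW (archi_boundP (sqnorm2_ge0 _))))// ler_nat//.
have Icvg (f : T -> R) w : (I N w * f w)%:E @[N --> \oo] --> (f w)%:E.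
  apply: cvg_near_cst; apply: filterS (Inear w) => N ->; by rewrite mul1r.
have c1 : (\int[P]_w (I N w * phi w)%:E)%E @[N --> \oo] --> (\int[P]_w (phi w)%:E)%E.
  have := @cvg_monotone_convergence _ _ _ P setT measurableT
    (fun N w => (I N w * phi w)%:E).
  rewrite (_ : (fun x => limn _) = (fun w => (phi w)%:E)); last first.
    by apply/funext => w; apply/cvg_lim => //; exact: Icvg.
  apply.
  - by move=> N; apply/measurable_EFinP; exact: measurable_funM.
  - by move=> N w _; rewrite lee_fin mulr_ge0//; have /andP[] := I01 N w.
  - move=> w _ N1 N2 N12; rewrite lee_fin ler_wpM2r// /I.
    case: (leP (sqnorm2 (D w)) N1%:R) => // h; rewrite (le_trans h)// ler_nat//.
have c2 : (\int[P]_w (I N w * dot (G w) (D w))%:E)%E @[N --> \oo] -->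
    (\int[P]_w (dot (G w) (D w))%:E)%E.
  have mGD := L1_measurable LGD.
  have LaGD : P.-integrable setT (fun w => `|dot (G w) (D w)|%:E).
    apply: (L1_le _ _ LGD); first exact: measurableT_comp.
    by move=> w; rewrite normr_id.
  have [] := @dominated_convergence _ _ _ P setT measurableT
    (fun N w => (I N w * dot (G w) (D w))%:E) (fun w => (dot (G w) (D w))%:E)
    (fun w => `|dot (G w) (D w)|%:E) => //.
  - by move=> N; apply/measurable_EFinP; exact: measurable_funM.
  - exact/measurable_EFinP.
  - by apply/aeW => w _; exact: (Icvg (fun w => dot (G w) (D w)) w).
  - apply/aeW => w N _; rewrite lee_fin normrM ler_piMl// ger0_norm;
      by have /andP[] := I01 N w.
have le12 : (\int[P]_w (phi w)%:E <= \int[P]_w (dot (G w) (D w))%:E)%E.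
  rewrite -(cvg_lim _ c1)// -(cvg_lim _ c2)//; apply: lee_lim.
  - by apply/cvg_ex; eexists; exact: c1.
  - by apply/cvg_ex; eexists; exact: c2.
  - by apply: nearW.
have Lphi : P.-integrable setT (EFin \o phi).
  apply: expectation_lty => //; rewrite expectation.unlock (le_lt_trans le12)//.
  by rewrite -ge0_fin_numE ?integrable_fin_num// (le_trans _ le12)// integral_ge0// => w _; rewrite lee_fin.
split=> //; rewrite fine_le// integrable_fin_num//.
Qed.

(** * Stochastic gradient descent *)

Lemma sqnorm2BC (R : realType) (k : nat) (a b : 'cV[R]_k) :
  sqnorm2 (a - b) = sqnorm2 (b - a).
Proof. by rewrite -sqnorm2N opprB. Qed.

Lemma fun_norm2_sqr (R : realType) (T : Type) (m k : nat) (X : T -> 'M[R]_(m, k)) :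
  (fun w => norm2 (X w) ^+ 2) = (fun w => sqnorm2 (X w)).
Proof. by apply/funext => w; rewrite norm2_sqr. Qed.

Section StochasticDescent.
Context d (T : measurableType d) (R : realType) (P : probability T R).
Variables (n k : nat) (F : 'cV[R]_k -> R) (vs : 'cV[R]_k).
Hypothesis F_convex : forall a b, F a + dot (gradient F a) (b - a) <= F b.
Hypothesis F_min : forall a, F vs <= F a.
Hypothesis F_meas : forall V : T -> 'cV[R]_k, random_vector V ->
  measurable_fun setT (fun w => F (V w)).
(** [W] stands for the whole parameter vector, on which the gradients are conditioned; [coord]
    locates in it the last-layer iterate [v]. *)
Variables (coord : 'I_k -> 'I_n) (W : nat -> T -> 'cV[R]_n).
Variables (v g : nat -> T -> 'cV[R]_k) (eta : nat -> R) (G : R) (tau : nat).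
Hypothesis W_meas : forall t, (tau <= t)%N -> random_vector (W t).
Hypothesis g_meas : forall t, (tau <= t)%N -> random_vector (g t).
Hypothesis vW : forall t w j, (tau <= t)%N -> v t w j 0 = W t w (coord j) 0.
Hypothesis g_cond : forall t, (tau <= t)%N ->
  cond_expectation_eq P (g t) (W t) (fun w => gradient F (v t w)).
Hypothesis g_bound : forall t, (tau <= t)%N ->
  ('E_P[fun w => (norm2 (g t w) ^+ 2)%R] <= (G ^+ 2)%:E)%E.
Hypothesis vS : forall t w, (tau <= t)%N -> v t.+1 w = v t w - eta t *: g t w.
Hypothesis eta_ge0 : forall t, (tau <= t)%N -> 0 <= eta t.

Notation L1 f := (P.-integrable setT (EFin \o f)).
Notation E f := (Rintegral P setT f).

Lemma iterate_random t : (tau <= t)%N -> random_vector (v t).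
Proof. by move=> tt j; under eq_fun do rewrite (vW _ _ tt); exact: W_meas. Qed.

Let L1_g t : (tau <= t)%N -> L1 (fun w => sqnorm2 (g t w)).
Proof.
move=> tt; apply: expectation_lty.
- by apply: measurable_sqnorm2; exact: g_meas.
- by move=> w; exact: sqnorm2_ge0.
- have := g_bound tt; rewrite fun_norm2_sqr.
  by move=> /le_lt_trans; apply; rewrite ltry.
Qed.

Let E_g t : (tau <= t)%N -> E (fun w => sqnorm2 (g t w)) <= G ^+ 2.
Proof.
move=> tt; rewrite -lee_fin -expectation_Rintegral; last exact: L1_g.
by have := g_bound tt; rewrite fun_norm2_sqr.
Qed.

Lemma sgd_gap_le t : (tau <= t)%N -> L1 (fun w => sqnorm2 (v t w - vs)) ->
  L1 (fun w => F (v t w) - F vs) /\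
  E (fun w => F (v t w) - F vs) <= E (fun w => dot (g t w) (v t w - vs)).
Proof.
move=> tt LD.
apply: (cond_expectation_dot_le (W_meas tt) (g_meas tt) _ (L1_g tt) LD (g_cond tt)).
- move=> j; rewrite (_ : (fun _ => _) =
    (fun w : generated_type (W t) => W t w (coord j) 0 - vs j 0)).
    apply: measurable_funB => //; exact: generated_coord.
  by apply/funext => w; rewrite !mxE vW.
- by apply: measurable_funB => //; exact/F_meas/iterate_random.
- move=> w; rewrite subr_ge0 F_min/=.
  have := F_convex (v t w) vs; rewrite -[vs - _]opprB dotNr; lra.
Qed.

(** Expansion of the squared distance after one update, the cross term being bounded by
    [sgd_gap_le]. Integrability of the distance is passed on along with the estimate, since the next
    step needs it. *)
Lemma sgd_step t : (tau <= t)%N -> L1 (fun w => sqnorm2 (v t w - vs)) ->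
  L1 (fun w => sqnorm2 (v t.+1 w - vs)) /\
  2 * eta t * E (fun w => F (v t w) - F vs) + E (fun w => sqnorm2 (v t.+1 w - vs))
    <= E (fun w => sqnorm2 (v t w - vs)) + G ^+ 2 * eta t ^+ 2.
Proof.
move=> tt LD; have [Lphi phi_le] := sgd_gap_le tt LD.
have mD : random_vector (fun w => v t w - vs).
  by apply: random_vectorB; [exact: iterate_random|exact: random_vector_cst].
have Ldot : L1 (fun w => dot (g t w) (v t w - vs)).
  apply: L1_sum => j; apply: L1_mul_sq; [exact: g_meas|exact: mD| |].
    by apply: L1_coord_sq; [exact: g_meas|exact: L1_g].
  exact: (L1_coord_sq j mD).
have step w : sqnorm2 (v t.+1 w - vs) = sqnorm2 (v t w - vs) +
    (eta t ^+ 2 * sqnorm2 (g t w) - 2 * eta t * dot (g t w) (v t w - vs)).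
  rewrite vS// [X in sqnorm2 X = _]addrAC (sqnorm2D (v t w - vs)) dotNr dotZr sqnorm2N sqnorm2Z dotC; ring.
have Lg := L1_g tt.
have L2 : L1 (fun w => eta t ^+ 2 * sqnorm2 (g t w) -
    2 * eta t * dot (g t w) (v t w - vs)).
  by apply: L1_sub; exact: L1_scale.
rewrite (funext step); split; first exact: L1_add.
set ephi := E (fun w => F (v t w) - F vs) in phi_le *.
rewrite RintegralD// RintegralB//; [|exact: L1_scale..].
rewrite !RintegralZl//.
have := ler_wpM2l (sqr_ge0 (eta t)) (E_g tt).
have := ler_wpM2l (eta_ge0 tt) phi_le.
rewrite [G ^+ 2 * _]mulrC; lra.
Qed.

Lemma sgd_descent m : L1 (fun w => sqnorm2 (v tau w - vs)) ->
  L1 (fun w => sqnorm2 (v (tau + m)%N w - vs)) /\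
  2 * \sum_(tau <= j < tau + m) eta j * E (fun w => F (v j w) - F vs) +
    E (fun w => sqnorm2 (v (tau + m)%N w - vs)) <=
  E (fun w => sqnorm2 (v tau w - vs)) +
    G ^+ 2 * \sum_(tau <= j < tau + m) eta j ^+ 2.
Proof.
move=> L0; elim: m => [|m [LD IH]].
  by rewrite addn0 !big_geq// !mulr0 add0r addr0.
have [LD' st] := sgd_step (leq_addr m tau) LD; rewrite addnS; split=> //.
rewrite !big_nat_recr ?leq_addr//= !mulrDr; lra.
Qed.

(** The selector [s] is an arbitrary function of the outcome; measurability holds because the
    selected value is the minimum of finitely many measurable functions. *)
Lemma best_iterate_measurable (f : nat -> T -> R) (s : T -> nat) m :
  (forall j, (tau <= j <= tau + m)%N -> measurable_fun setT (f j)) ->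
  (forall w, (tau <= s w <= tau + m)%N /\
    forall j, (tau <= j <= tau + m)%N -> f (s w) w <= f j w) ->
  measurable_fun setT (fun w => f (s w) w).
Proof.
move=> mf sP.
pose mn := fix mn i : T -> R := if i is i'.+1 then
  fun w => Num.min (mn i' w) (f (tau + i)%N w) else f tau.
have mmn i : (i <= m)%N -> measurable_fun setT (mn i).
  elim: i => [_|i IH im]; first by apply: mf; rewrite leqnn leq_addr.
  apply: measurable_minr; first exact/IH/ltnW.
  by apply: mf; rewrite leq_addr leq_add2l.
rewrite (_ : (fun _ => _) = mn m); first exact: mmn.
apply/funext => w; have [/andP[s1 s2] smin] := sP w; apply/eqP; rewrite eq_le.
apply/andP; split.
  have : forall i, (i <= m)%N -> f (s w) w <= mn i w.
    elim=> [_|i IH im] /=; first by apply: smin; rewrite leqnn leq_addr.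
    by rewrite le_min IH ?(ltnW im)// smin// leq_addr leq_add2l.
  exact.
have : forall i j, (j <= i)%N -> mn i w <= f (tau + j)%N w.
  elim=> [j|i IH j].
    by rewrite leqn0 => /eqP j0; rewrite j0 addn0.
  rewrite leq_eqVlt => /predU1P[->|ji]; first by rewrite /= ge_min lexx orbT.
  by rewrite /= ge_min IH.
by move=> /(_ m (s w - tau)%N); rewrite subnKC// leq_subLR; apply.
Qed.

Lemma sgd_rate (t : nat) (s : T -> nat) : (tau <= t)%N ->
  (forall w, (tau <= s w <= t)%N /\
    forall j, (tau <= j <= t)%N -> F (v (s w) w) <= F (v j w)) ->
  ('E_P[fun w => F (v (s w) w)] - (F vs)%:E <=
   ('E_P[fun w => (norm2 (vs - v tau w) ^+ 2)%R]
     + (G ^+ 2 * \sum_(tau <= j < t.+1) eta j ^+ 2)%:E)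
   / (2 * \sum_(tau <= j < t.+1) eta j)%:E)%E.
Proof.
move=> taut sP.
set Q := \sum_(tau <= j < t.+1) eta j ^+ 2; set S := \sum_(tau <= j < t.+1) eta j.
have S0 : 0 <= S.
  by rewrite /S big_nat_cond sumr_ge0// => j /andP[/andP[tj _] _]; exact: eta_ge0.
have Q0 : 0 <= Q by rewrite sumr_ge0// => j _; exact: sqr_ge0.
have eD : (fun w => norm2 (vs - v tau w) ^+ 2) = (fun w => sqnorm2 (v tau w - vs)).
  by apply/funext => w; rewrite norm2_sqr sqnorm2BC.
rewrite eD.
have mD : measurable_fun setT (fun w => sqnorm2 (v tau w - vs)).
  apply: measurable_sqnorm2; apply: random_vectorB; last exact: random_vector_cst.
  exact: iterate_random.
(* Positive even when [S = 0], the inverse then being [+oo]; so an infinite expected initial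
   distance makes the right-hand side [+oo]. *)
have inv0 : (0 < (2 * S)%:E^-1)%E.
  rewrite inver; have [//|S1] := eqVneq (2 * S) 0.
  by rewrite lte_fin invr_gt0 lt_neqAle eq_sym S1 mulr_ge0.
have [D_oo|] := eqVneq ('E_P[fun w => sqnorm2 (v tau w - vs)])%E +oo%E.
  by rewrite D_oo addye ?ltNyr// gt0_mulye// leey.
rewrite -ltey => /(expectation_lty mD (fun w => sqnorm2_ge0 _)) LD.
pose phi j w := F (v j w) - F vs.
have LDj j : (tau <= j)%N -> L1 (fun w => sqnorm2 (v j w - vs)).
  by move=> tj; have [] := sgd_descent (j - tau) LD; rewrite subnKC.
have Lphi j : (tau <= j)%N -> L1 (phi j).
  by move=> tj; have [] := sgd_gap_le tj (LDj j tj).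
pose best w := phi (s w) w.
have best0 w : 0 <= best w by rewrite subr_ge0 F_min.
have best_le j w : (tau <= j <= t)%N -> best w <= phi j w.
  by move=> tj; rewrite lerD2r; have [_] := sP w; apply.
have mbest : measurable_fun setT best.
  apply: (@best_iterate_measurable phi s (t - tau)) => [j|w].
    by rewrite subnKC// => /andP[tj _]; exact/L1_measurable/Lphi.
  by rewrite subnKC//; have [h1 h2] := sP w; split=> // j /h2; rewrite lerD2r.
have Lbest : L1 best.
  apply: (L1_le mbest _ (Lphi tau (leqnn _))) => w.
  have tt : (tau <= tau <= t)%N by rewrite leqnn.
  by rewrite ger0_norm// (le_trans (best_le tau w tt))// ler_norm.
have bestE j : (tau <= j <= t)%N -> E best <= E (phi j).
  move=> tj; apply: le_Rintegral => //; last by move=> w _; exact: best_le.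
  by apply: Lphi; case/andP: tj.
have -> : ('E_P[fun w => F (v (s w) w)] - (F vs)%:E)%E = (E best)%:E.
  have -> : (fun w => F (v (s w) w)) = (fun w => best w + cst (F vs) w).
    by apply/funext => w; rewrite /best /phi subrK.
  rewrite expectation_Rintegral; last by apply: L1_add => //; exact: L1_cst.
  rewrite RintegralD//; last exact: L1_cst.
  rewrite Rintegral_cst// (_ : fine _ = 1); last exact: (congr1 fine (probability_setT P)).
  by rewrite mulr1 -EFinB addrK.
rewrite expectation_Rintegral// -EFinD.
set A := E (fun w => sqnorm2 (v tau w - vs)).
have A0 : 0 <= A by apply: Rintegral_ge0 => w _; exact: sqnorm2_ge0.
have key : 2 * S * E best <= A + G ^+ 2 * Q.
  have := (sgd_descent (t.+1 - tau) LD).2; rewrite subnKC; last exact: leqW.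
  have := @Rintegral_ge0 _ _ _ P setT (fun w => sqnorm2 (v t.+1 w - vs))
    (fun w _ => sqnorm2_ge0 _).
  have : S * E best <= \sum_(tau <= j < t.+1) eta j * E (phi j).
    rewrite /S mulr_suml big_nat_cond [leRHS]big_nat_cond; apply: ler_sum => j.
    move=> /andP[/andP[tj jt] _]; rewrite ler_wpM2l ?eta_ge0//.
    by apply: bestE; rewrite tj -ltnS.
  rewrite /phi -/A -/Q; lra.
have GQ0 : 0 <= G ^+ 2 * Q by rewrite mulr_ge0// sqr_ge0.
(* Since [0^-1 = +oo] in [\bar R], vanishing step sizes leave a claim only when
   the initial point is almost surely the minimizer [vs]. *)
have [S_eq0|S_neq0] := eqVneq S 0.
  rewrite S_eq0 mulr0 inve0.
  have [AQ|AQ] := eqVneq (A + G ^+ 2 * Q) 0; last first.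
    by rewrite gt0_muley ?leey// lte_fin lt_neqAle eq_sym AQ addr_ge0.
  rewrite AQ mul0e lee_fin.
  have A_eq0 : A = 0 by apply/eqP; rewrite eq_le A0 andbT -AQ lerDl.
  apply: (le_trans (bestE tau _)); first by rewrite leqnn.
  suff -> : E (phi tau) = E (cst 0) by rewrite Rintegral_cst// mul0r.
  rewrite /Rintegral; congr fine.
  apply: ae_eq_integral => //; first exact/measurable_EFinP/L1_measurable/Lphi.
    by apply/measurable_EFinP; exact: measurable_cst.
  have /(ae_eq_integral_abs P measurableT) : measurable_fun setT
    (EFin \o (fun w => sqnorm2 (v tau w - vs))) by exact/measurable_EFinP.
  move=> [+ _]; rewrite (_ : (\int[P]_(x in _) _)%E = A%:E); last first.
    rewrite /A /Rintegral fineK ?integrable_fin_num//; apply: eq_integral => w _.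
    by rewrite /= ger0_norm// sqnorm2_ge0.
  rewrite A_eq0 => /(_ erefl); apply: filterS => w /(_ I)/=[h] _.
  by rewrite /phi (_ : v tau w = vs) ?subrr//; apply/eqP; rewrite -subr_eq0; apply/eqP/sqnorm2_eq0.
have Spos : 0 < 2 * S by rewrite mulr_gt0// lt_neqAle eq_sym S_neq0.
by rewrite inver gt_eqF// -EFinM lee_fin ler_pdivlMr// mulrC.
Qed.

End StochasticDescent.

(** * The two-phase training procedure *)

(* A nonpositive smoothness constant would make the step size [L_H^-1] junk, but
   nonnegative losses are then constant. *)
Lemma smoothness_const_le0 (R : realType) (n mH my dh : nat)
    (hX : 'cV[R]_dh -> 'M[R]_(n, mH)) (ell : 'cV[R]_my -> 'cV[R]_my -> R)
    (y : 'I_n -> 'cV[R]_my) (u : 'cV[R]_dh) (Lell : R) :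
  (forall i q, 0 <= ell q (y i)) ->
  (forall i q, differentiable (ell^~ (y i)) q) ->
  (forall i q q', norm2 (gradient (ell^~ (y i)) q - gradient (ell^~ (y i)) q')
      <= Lell * norm2 (q - q')) ->
  smoothness_const hX Lell u <= 0 ->
  (forall v v', last_objective hX ell y u v = last_objective hX ell y u v') /\
  (smoothness_const hX Lell u < 0 ->
    forall v : 'cV[R]_(my * (mH + 1)), sqnorm2 v = 0).
Proof.
move=> ell0 elld lip.
set S := \sum_i norm2 (row i (augment (hX u))) ^+ 2.
have LE : smoothness_const hX Lell u = Lell / n%:R * S by [].
(* The column of ones carrying the bias makes every row norm positive, so the sign of L_H is that of
   [Lell] once there is a sample. *)
have S_gt0 (i : 'I_n) : 0 < S.
  rewrite /S (bigD1 i)//= ltr_wpDr ?sumr_ge0// => [l _|]; first exact: sqr_ge0.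
  rewrite norm2_sqr /sqnorm2 big_ord1 (bigD1 (rshift mH 0))//= ltr_wpDr//.
    by rewrite sumr_ge0// => l _; exact: sqr_ge0.
  by rewrite mxE row_mxEr mxE expr1n.
move=> L0; have Lell_le0 (i : 'I_n) : Lell <= 0.
  have n0 : (0 : R) < n%:R by rewrite ltr0n (leq_ltn_trans _ (ltn_ord i)).
  by move: L0; rewrite LE pmulr_lle0 ?S_gt0// pmulr_lle0// invr_gt0.
split=> [v v'|Lneg v].
  rewrite !last_objectiveE; congr (_ * _); apply: eq_bigr => i _.
  by apply: (nonpos_lipschitz_cst (Lell_le0 i) (ell0 i) (elld i) (lip i)).
have n_neq0 : n != 0%N.
  apply/eqP => n0; have nR : n%:R = 0 :> R by rewrite n0.
  by move: Lneg; rewrite LE nR invr0 mulr0 mul0r ltxx.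
have i : 'I_n by case: (n) n_neq0 => // n' _; exact: ord0.
have n0 : (0 : R) < n%:R by rewrite ltr0n lt0n.
have {}Lneg : Lell < 0.
  by move: Lneg; rewrite LE pmulr_llt0 ?S_gt0// pmulr_llt0// invr_gt0.
(* A negative Lipschitz constant leaves room for a single output vector; the output dimension is
   then 0 and so is the dimension of the last layer. *)
have q0 (q : 'cV[R]_my) : q = 0.
  apply: sqnorm2_eq0; rewrite -norm2_sqr; apply/eqP; rewrite sqrf_eq0 eq_le norm2_ge0.
  have := le_trans (norm2_ge0 _) (lip i q 0); rewrite subr0 andbT.
  by rewrite nmulr_rge0.
have my0 : my = 0%N.
  case: (posnP my) => // my_gt0; have /matrixP /(_ (Ordinal my_gt0) 0) := q0 (const_mx 1).
  by rewrite !mxE => /eqP; rewrite oner_eq0.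
rewrite sqnorm2_cV big1// => l _.
by have := ltn_ord l; rewrite {2}my0 mul0n.
Qed.

Lemma first_phase_random (R : realType) d (T : measurableType d) (k : nat)
    (w0 : 'cV[R]_k) (eta : nat -> 'cV[R]_k) (g : nat -> T -> 'cV[R]_k) t :
  (forall t, random_vector (g t)) ->
  random_vector (fun w => first_phase w0 eta (g^~ w) t).
Proof.
move=> mg; elim: t => [|t IH] i /=; first exact: measurable_cst.
rewrite (_ : (fun _ => _) = (fun w => first_phase w0 eta (g^~ w) t i 0 -
    eta t i 0 * g t w i 0)).
  by apply: measurable_funB; [exact: IH|apply: measurable_funM => //; exact: mg].
by apply/funext => w; rewrite !mxE.
Qed.

(** Since the last layer alone reaches the global minimum, its minimizers form a level set, which is
    closed by continuity. *)
Lemma last_argminE (R : realType) (n mH my dh : nat)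
    (hX : 'cV[R]_dh -> 'M[R]_(n, mH)) (ell : 'cV[R]_my -> 'cV[R]_my -> R)
    (y : 'I_n -> 'cV[R]_my) (u : 'cV[R]_dh) (wstar : 'cV[R]_(dh + my * (mH + 1))) :
  expressivity_det hX u != 0 ->
  (forall w, objective hX ell y wstar <= objective hX ell y w) ->
  last_argmin (objective hX ell y) u =
    last_objective hX ell y u @^-1` [set objective hX ell y wstar].
Proof.
move=> det0 wmin; have [v0 v0E] := last_objective_attains ell y det0 wstar.
apply/seteqP; split => v /= vE.
  by apply/eqP; rewrite eq_le -{1}v0E (vE v0) wmin.
by move=> v'; rewrite -/(last_objective hX ell y u v) vE.
Qed.

Lemma last_gradientE (R : realType) (n mH my dh : nat)
    (hX : 'cV[R]_dh -> 'M[R]_(n, mH)) (ell : 'cV[R]_my -> 'cV[R]_my -> R)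
    (y : 'I_n -> 'cV[R]_my) (u : 'cV[R]_dh) (v : 'cV[R]_(my * (mH + 1))) :
  last_gradient (objective hX ell y) (col_mx u v) =
  gradient (last_objective hX ell y u) v.
Proof. by rewrite /last_gradient col_mxKu col_mxKd. Qed.

Theorem theorem1 (R : realType)
  (* dataset, loss and architecture *)
  (n mx my mH H : nat) (dim : 'I_H -> nat)
  (calX : set 'cV[R]_mx) (calY : set 'cV[R]_my)
  (x : 'I_n -> 'cV[R]_mx) (y : 'I_n -> 'cV[R]_my)
  (ell : 'cV[R]_my -> 'cV[R]_my -> R)
  (h : ('I_n -> 'cV[R]_mx) -> 'cV[R]_(\sum_(l < H) dim l)%N -> 'M[R]_(n, mH))
  (Lell : R)
  (H_ge2 : (2 <= H)%N)
  (x_in : forall i, calX (x i)) (y_in : forall i, calY (y i))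
  (ell_ge0 : forall q z, calY z -> 0 <= ell q z)
  (expressivity : exists u, expressivity_det (h x) u != 0)
  (ell_diff : forall i q, differentiable (ell^~ (y i)) q)
  (ell_convex : forall i, convex_function setT (ell^~ (y i)))
  (ell_lipschitz : forall i q q',
    norm2 (gradient (ell^~ (y i)) q - gradient (ell^~ (y i)) q')
      <= Lell * norm2 (q - q'))
  (h_analytic : forall i j, real_analytic (fun u => h x u i j))
  (* global minimum *)
  (wstar : 'cV[R]_(\sum_(l < H) dim l + my * (mH + 1)))
  (wstar_min : forall w, objective (h x) ell y wstar <= objective (h x) ell y w)
  (* first phase; its updates may be random *)
  (dO : measure_display) (Omega : measurableType dO) (P : probability Omega R)
  (tau : nat) (w0 : 'cV[R]_(\sum_(l < H) dim l + my * (mH + 1)))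
  (eta1 : nat -> 'cV[R]_(\sum_(l < H) dim l + my * (mH + 1)))
  (g1 : nat -> Omega -> 'cV[R]_(\sum_(l < H) dim l + my * (mH + 1)))
  (g1_meas : forall t, random_vector (g1 t))
  (* hidden-layer parameters reached by the first phase, conditioned upon *)
  (u : 'cV[R]_(\sum_(l < H) dim l)%N)
  (hidden_u : forall omega, usubmx (first_phase w0 eta1 (g1^~ omega) tau) = u)
  (* noise *)
  (dD : measure_display) (Delta : measurableType dD) (PD : probability Delta R)
  (sigma : 'I_H -> R) (delta : Delta -> 'cV[R]_(\sum_(l < H) dim l)%N)
  (sigma_gt0 : forall l, 0 < sigma l)
  (delta_gaussian : block_gaussian PD sigma delta) :
  {ae PD, forall z,
    let L := objective (h x) ell y in
    let utau := u + delta z in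
    let vtau omega := dsubmx (first_phase w0 eta1 (g1^~ omega) tau) in
    let LH := smoothness_const (h x) Lell utau in
    exists R2 : \bar R,
    [/\ is_minimum
          [set 'E_P[fun omega => (norm2 (v - vtau omega) ^+ 2)%R]%E
             | v in last_argmin L utau] R2,
        (* gradient descent *)
        (forall w : nat -> 'cV[R]_(\sum_(l < H) dim l + my * (mH + 1)),
          (forall omega, w tau = col_mx utau (vtau omega)) ->
          (forall t, (tau <= t)%N ->
            w t.+1 = col_mx (usubmx (w t))
                            (dsubmx (w t) - LH^-1 *: last_gradient L (w t))) ->
          forall t, (tau < t)%N ->
            ((L (w t) - L wstar)%:E <= R2 * LH%:E / (2 * (t - tau)%N%:R)%:E)%E) &
        (* stochastic gradient descent *)
        (forall (w : nat -> Omega -> 'cV[R]_(\sum_(l < H) dim l + my * (mH + 1)))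
            (g : nat -> Omega -> 'cV[R]_(my * (mH + 1)))
            (eta : nat -> R) (G : R),
          (forall omega, w tau omega = col_mx utau (vtau omega)) ->
          (forall t, (tau <= t)%N -> random_vector (g t)) ->
          (forall t, (tau <= t)%N ->
            cond_expectation_eq P (g t) (w t)
              (fun omega => last_gradient L (w t omega))) ->
          (forall t, (tau <= t)%N ->
            ('E_P[fun omega => (norm2 (g t omega) ^+ 2)%R] <= (G ^+ 2)%:E)%E) ->
          (forall t omega, (tau <= t)%N ->
            w t.+1 omega = col_mx (usubmx (w t omega))
                                  (dsubmx (w t omega) - eta t *: g t omega)) ->
          (forall t, (tau <= t)%N -> 0 <= eta t) ->
          cvgn (fun N => \sum_(tau <= t < N) eta t ^+ 2) ->
          (fun N => \sum_(tau <= t < N) eta t) @ \oo --> +oo ->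
          forall (t : nat) (tstar : Omega -> nat), (tau < t)%N ->
            (forall omega, (tau <= tstar omega <= t)%N /\
              forall k, (tau <= k <= t)%N ->
                L (w (tstar omega) omega) <= L (w k omega)) ->
            ('E_P[fun omega => L (w (tstar omega) omega)] - (L wstar)%:E <=
             (R2 + (G ^+ 2 * \sum_(tau <= k < t.+1) eta k ^+ 2)%:E)
               / (2 * \sum_(tau <= k < t.+1) eta k)%:E)%E)]}.
Proof.
have ell0 i q : 0 <= ell q (y i) by exact: ell_ge0.
apply: filterS (expressivity_ae u sigma_gt0 delta_gaussian h_analytic expressivity).
move=> z det0 /=; set L := objective (h x) ell y; set utau := u + delta z.
set LH := smoothness_const (h x) Lell utau.
pose vtau omega := dsubmx (first_phase w0 eta1 (g1^~ omega) tau).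
pose F := last_objective (h x) ell y utau.
have argminE : last_argmin L utau = F @^-1` [set L wstar] by exact: last_argminE.
have cF : continuous F by exact: last_objective_continuous.
have F_convex a b : F a + dot (gradient F a) (b - a) <= F b.
  exact: last_objective_convex.
have mvtau : random_vector vtau.
  move=> i; under eq_fun do rewrite mxE.
  exact: (first_phase_random w0 eta1 tau g1_meas).
have [R2 R2min] : exists R2 : \bar R, is_minimum
    [set 'E_P[fun omega => (norm2 (v - vtau omega) ^+ 2)%R]%E
       | v in last_argmin L utau] R2.
  apply: expected_sqdist_min => //.
    by rewrite argminE; apply: closed_comp => // v _; exact: cF.
  have [v0 v0E] := last_objective_attains ell y det0 wstar.
  by exists v0; rewrite argminE.
exists R2; split => //.
  move=> w wtau wS t taut.
  have [[vbar]] := R2min; rewrite argminE => /= Fvbar R2E _.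
  have wE m : w (tau + m)%N = col_mx utau (dsubmx (w (tau + m)%N)).
    elim: m => [|m IH].
      (* The initial condition is stated for each outcome, so an outcome is needed; total mass 1
         provides one. *)
      have [omega _] : exists omega : Omega, True.
        apply: contrapT => noO; have := probability_setT P.
        rewrite (_ : setT = set0) ?measure0; first by move=> /eqP; rewrite eq_sym onee_eq0.
        by apply/seteqP; split => // o _; apply: noO; exists o.
      by rewrite (addn0 tau) (wtau omega) col_mxKd.
    by rewrite (addnS tau) wS ?leq_addr// {1}IH col_mxKu col_mxKd.
  pose v m := dsubmx (w (tau + m)%N).
  have LE m : L (w (tau + m)%N) = F (v m) by rewrite wE.
  have vS m : v m.+1 = v m - LH^-1 *: gradient F (v m).
    have -> : v m.+1 = dsubmx (w (tau + m)%N.+1).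
      by congr (dsubmx (w _)); exact: addnS.
    have gE : last_gradient L (w (tau + m)%N) = gradient F (v m).
      by rewrite {1}wE; exact: last_gradientE.
    by rewrite (wS _ (leq_addr m tau)) col_mxKd gE.
  (* The trajectory [w] is deterministic and starts at [vtau omega] for every outcome, so [vtau] is
     constant and the expectation is a plain squared distance. *)
  have R2v : R2 = (sqnorm2 (vbar - v 0%N))%:E.
    rewrite -R2E -[RHS](expectation_cst P); congr ('E_P[ _ ])%E.
    apply/funext => omega; rewrite norm2_sqr /v (addn0 tau).
    by rewrite (wtau omega) col_mxKd.
  have tE : t = (tau + (t - tau))%N by rewrite subnKC// ltnW.
  have s_gt0 : (0 : R) < (t - tau)%N%:R by rewrite ltr0n subn_gt0.
  have den0 : 0 < 2 * (t - tau)%N%:R :> R by rewrite mulr_gt0.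
  rewrite {1}tE LE -Fvbar R2v inver gt_eqF// -!EFinM lee_fin ler_pdivlMr//.
  (* For a nonpositive constant the gap is 0, and so is the bound: either L_H is 0 or the last layer
     has dimension 0. *)
  have [LH_le0|LH_gt0] := leP LH 0.
    have [cst neg] := smoothness_const_le0 ell0 ell_diff ell_lipschitz LH_le0.
    rewrite (_ : F _ = F vbar) ?subrr ?mul0r; last exact: cst.
    move: LH_le0; rewrite le_eqVlt => /predU1P[->|/neg ->]; first by rewrite mulr0.
    by rewrite mul0r.
  have Lell0 : 0 <= Lell.
    rewrite leNgt; apply/negP => Lneg; move: LH_gt0; apply/negP; rewrite -leNgt.
    rewrite mulr_le0_ge0 ?sumr_ge0// => [|i _]; last exact: sqr_ge0.
    by rewrite mulr_le0_ge0 ?invr_ge0// ltW.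
  have dF := last_objective_descent (h x) utau ell_diff Lell0 ell_lipschitz.
  have := gradient_descent_rate vbar LH_gt0 F_convex dF vS (t - tau)%N.
  lra.
move=> w g eta G wtau g_meas g_cond g_bound wS eta_ge0 _ _ t tstar taut tstarP.
have [[vbar]] := R2min; rewrite argminE => /= Fvbar <- _.
have wE m omega : (tau <= m)%N -> w m omega = col_mx utau (dsubmx (w m omega)).
  move=> /subnKC <-; elim: (m - tau)%N => [|m' IH].
    by rewrite (addn0 tau) wtau col_mxKd.
  by rewrite (addnS tau) wS ?leq_addr// {1}IH col_mxKu col_mxKd.
pose v m omega := dsubmx (w m omega).
have LE m omega : (tau <= m)%N -> L (w m omega) = F (v m omega).
  by move=> tm; rewrite {1}wE.
have vS m omega : (tau <= m)%N -> v m.+1 omega = v m omega - eta m *: g m omega.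
  by move=> tm; rewrite /v wS// col_mxKd.
(* Measurability of the iterates is inherited from the first phase and from the stochastic
   gradients, the hidden block being constant. *)
have mw m : (tau <= m)%N -> random_vector (w m).
  move=> /subnKC <-; elim: (m - tau)%N => [|m' IH] i.
    rewrite (addn0 tau) (funext wtau); case: (split_ordP i) => j ->.
      by under eq_fun do rewrite col_mxEu; exact: measurable_cst.
    by under eq_fun do rewrite col_mxEd; exact: mvtau.
  rewrite (addnS tau) (_ : w _ = (fun omega => col_mx utau
    (dsubmx (w (tau + m')%N omega) - eta (tau + m')%N *: g (tau + m')%N omega))); last first.
    by apply/funext => omega; rewrite wS ?leq_addr// {1}wE ?leq_addr// col_mxKu.
  case: (split_ordP i) => j ->.
    by under eq_fun do rewrite col_mxEu; exact: measurable_cst.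
  under eq_fun do rewrite col_mxEd.
  apply: (random_vectorB (X := fun omega => dsubmx (w (tau + m')%N omega))).
    by move=> l; under eq_fun do rewrite mxE; exact: IH.
  by apply: random_vectorZ; apply: g_meas; exact: leq_addr.
have g_cond' m : (tau <= m)%N ->
    cond_expectation_eq P (g m) (w m) (fun omega => gradient F (v m omega)).
  move=> tm.
  have gE omega : last_gradient L (w m omega) = gradient F (v m omega).
    rewrite {1}(wE m omega tm); exact: last_gradientE.
  by rewrite -(funext gE); exact: g_cond.
have F_min a : F vbar <= F a by rewrite Fvbar wstar_min.
have mF (V : Omega -> 'cV[R]_(my * (mH + 1))) : random_vector V ->
    measurable_fun setT (fun omega => F (V omega)).
  exact: last_objective_measurable.
have := @sgd_rate _ _ _ P _ _ F vbar F_convex F_min mF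
  (fun j => rshift (\sum_(l < H) dim l)%N j) w v g eta G tau mw g_meas _
  g_cond' g_bound vS eta_ge0 t tstar (ltnW taut).
rewrite Fvbar.
rewrite (_ : (fun omega => F (v (tstar omega) omega)) =
    (fun omega => L (w (tstar omega) omega))); last first.
  by apply/funext => omega; rewrite LE//; have [/andP[]] := tstarP omega.
rewrite (_ : v tau = vtau); last first.
  by apply/funext => omega; rewrite /v wtau col_mxKd.
apply.
  by move=> m omega j tm; rewrite mxE.
move=> omega; have [h1 h2] := tstarP omega; split=> // j /andP[tj jt].
rewrite -!LE//; last by case/andP: h1.
by apply: h2; rewrite tj.
Qed.
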